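(* Let $\lambda$ be a strict partition of length $\le n$. Then $GB^{(n)}_\lambda(x|b)=\sum_{T\in\mathcal{T}''(\lambda)}\beta^{|T|-|\lambda|}(x|b)_I^T$, $GC^{(n)}_\lambda(x|b)=\sum_{T\in\mathcal{T}(\lambda)}\beta^{|T|-|\lambda|}(x|b)_I^T$, and $GD^{(n)}_\lambda(x|b)=\sum_{T\in\mathcal{T}'(\lambda)}\beta^{|T|-|\lambda|}(x|b)_{II}^T$.
   Context: $\beta$ indeterminate; $x\oplus y=x+y+\beta xy$, $x\ominus y=(x-y)/(1+\beta y)$. For a strict partition $\lambda=(\lambda_1>\dots>\lambda_r>0)$, $r\le n$: $GP_\lambda(x_1,\dots,x_n|b)=\frac1{(n-r)!}\sum_{w\in S_n}w\big[\prod_{j=1}^r\prod_{k=1}^{\lambda_j}(x_j\oplus b_k)\prod_{i=1}^r\prod_{j=i+1}^n\frac{x_i\oplus x_j}{x_i\ominus x_j}\big]$, and $GQ_\lambda$ the same with $\prod_{k=1}^{\lambda_j}(x_j\oplus b_k)$ replaced by $(x_j\oplus x_j)\prod_{k=1}^{\lambda_j-1}(x_j\oplus b_k)$. $GB^{(n)}_\lambda(x|b)=GP_\lambda(x_1,\dots,x_n|0,b_1,b_2,\dots)$, $GC^{(n)}_\lambda(x|b)=GQ_\lambda(x_1,\dots,x_n|b)$, $GD^{(n)}_\lambda(x|b)=GP_\lambda(x_1,\dots,x_n|b)$ if $n$ even and $GP_\lambda(x_1,\dots,x_n,0|b)$ if $n$ odd. Shifted diagram: $\mathbb{D}(\lambda)=\{(i,j):1\le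 i\le r,\ i\le j\le\lambda_i+i-1\}$. Alphabet $\mathcal{A}$: $1'<1<2'<2<\dots<n'<n$; $|a|=k$ for $a\in\{k,k'\}$. A set-valued shifted tableau of shape $\lambda$ is a map $T$ from $\mathbb{D}(\lambda)$ to nonempty subsets of $\mathcal{A}$ with (1) $\max T(i,j)\le\min T(i,j+1)$ and $\max T(i,j)\le\min T(i+1,j)$ whenever both boxes are in $\mathbb{D}(\lambda)$; (2) each unprimed letter appears at most once in each column; (3) each primed letter appears at most once in each row. $\mathcal{T}(\lambda)$ is the set of these; $\mathcal{T}'(\lambda)\subset\mathcal{T}(\lambda)$ consists of those with, for each diagonal box $(i,i)$, $T(i,i)$ containing only letters from $1,2',3,4',\dots$ if $i$ is odd and only from $1',2,3',4,\dots$ if $i$ is even; $\mathcal{T}''(\lambda)$ consists of those with no primed letter in any diagonal box. $|T|=\sum_{c}|T(c)|$. With $b_0=0$: $w_I(i,j;a)=x_a\oplus b_{j-i}$ if $a$ unprimed, $x_{|a|}\ominus b_{j-i}$ if $a$ primed; $w_{II}(i,j;a)$ is the same with $b_{j-i+1}$ in place of $b_{j-i}$. $(x|b)^T_I=\prod_{(i,j)\in\mathbb{D}(\lambda)}\prod_{a\in T(i,j)}w_I(i,j;a)$, and $(x|b)^T_{II}$ likewise with $w_{II}$.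
   Formalization: For GD with n odd, tableaux use n+1 letters with x_{n+1}=0 (as printed it fails for n=1, λ=(1): GD=x_1, tableau sum x_1⊕b_1); diagonal letters for i odd are read 1,2',3,4',… instead of the printed 1,2',3',4',…, which fails for n=4, λ=(1). *)

(* Defs.v *)
From HB Require Import structures.
From mathcomp Require Export all_boot all_order all_fingroup all_algebra.

Set Implicit Arguments.
Unset Strict Implicit.
Unset Printing Implicit Defensive.

Import GRing.Theory.
Local Open Scope ring_scope.

(* A strict partition is the strictly decreasing sequence of its (positive)
   parts. The parts are indexed from 0: [nth 0%N la j] is lambda_(j+1). *)
Definition strict_partition (la : seq nat) : bool :=
  sorted gtn la && (0%N \notin la).

Section FormalGroup.
Variables (F : fieldType) (beta : F).

Definition oplus (x y : F) : F := x + y + beta * x * y.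
Definition ominus (x y : F) : F := (x - y) / (1 + beta * y).

(* A parameter sequence (b_1, b_2, ...) is a function b with b k = b_(k+1).
   [cons0 b] is the sequence (0, b_1, b_2, ...); equivalently, [cons0 b k] is
   b_k with the convention b_0 = 0. *)
Definition cons0 (b : nat -> F) (k : nat) : F :=
  if k is k'.+1 then b k' else 0.

(* [head l y] is the factor attached to a part l and its variable y; the
   permutation w acts by substituting x_(w i) for x_i. *)
Definition symmetrization (head : nat -> F -> F) (la : seq nat)
    (n : nat) (x : n.-tuple F) : F :=
  ((n - size la)`!%:R)^-1 *
  \sum_(w : 'S_n)
    ((\prod_(j < n | (j < size la)%N) head (nth 0%N la j) (tnth x (w j))) *
     \prod_(i < n | (i < size la)%N) \prod_(j < n | (i < j)%N)
        (oplus (tnth x (w i)) (tnth x (w j)) /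
         ominus (tnth x (w i)) (tnth x (w j)))).

Definition GP (la : seq nat) (n : nat) (x : n.-tuple F) (b : nat -> F) : F :=
  symmetrization (fun l y => \prod_(k < l) oplus y (b k)) la x.

Definition GQ (la : seq nat) (n : nat) (x : n.-tuple F) (b : nat -> F) : F :=
  symmetrization (fun l y => oplus y y * \prod_(k < l.-1) oplus y (b k)) la x.

(* (x_1, ..., x_n) if n is even, (x_1, ..., x_n, 0) if n is odd. As GD is a GP
   in these n + odd n variables, its tableaux use n + odd n letters: for n odd
   the letters n+1 and (n+1)' occur, with x_(n+1) = 0. Restricting to n letters
   would be wrong for n odd: for n = 1 and lambda = (1), GD is x_1, while the
   only tableau has weight oplus x_1 b_1. *)
Definition evenpad (n : nat) (x : n.-tuple F) : (n + odd n).-tuple F :=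
  [tuple of x ++ nseq (odd n) 0].

Definition GB (la : seq nat) (n : nat) (x : n.-tuple F) (b : nat -> F) : F :=
  GP la x (cons0 b).
Definition GC (la : seq nat) (n : nat) (x : n.-tuple F) (b : nat -> F) : F :=
  GQ la x b.
Definition GD (la : seq nat) (n : nat) (x : n.-tuple F) (b : nat -> F) : F :=
  GP la (evenpad x) b.

End FormalGroup.

Section Tableaux.
Variables (la : seq nat) (n : nat).

(* The box of [Tagged _ k] with tag i lies in row i and column i + k, where
   k < lambda_(i+1); rows and columns are numbered from 0. *)
Definition box : finType := {i : 'I_(size la) & 'I_(nth 0%N la i)}.
Definition offset (c : box) : nat := tagged c.
Definition brow (c : box) : nat := tag c.
Definition bcol (c : box) : nat := (brow c + offset c)%N.

(* (k, true) is the letter k+1, and (k, false) is the letter (k+1)'. *)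
Definition letter : finType := ('I_n * bool)%type.
Definition unprimed (a : letter) : bool := a.2.
Definition letter_le (a a' : letter) : bool :=
  (a.1.*2 + a.2 <= a'.1.*2 + a'.2)%N.

Definition filling : finType := {ffun box -> {set letter}}.

(* For nonempty sets, max A <= min B. *)
Definition max_le_min (A B : {set letter}) : bool :=
  [forall a in A, [forall a' in B, letter_le a a']].

Definition tableau (T : filling) : bool :=
  [&& [forall c, T c != set0],
      [forall c, forall d, (brow d == brow c) && (bcol d == (bcol c).+1) ==>
                           max_le_min (T c) (T d)],
      [forall c, forall d, (brow d == (brow c).+1) && (bcol d == bcol c) ==>
                           max_le_min (T c) (T d)],
      [forall a, forall c, forall d,
         [&& unprimed a, a \in T c, a \in T d & bcol c == bcol d] ==> (c == d)]
    & [forall a, forall c, forall d,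
         [&& ~~ unprimed a, a \in T c, a \in T d & brow c == brow d]
         ==> (c == d)]].

Definition diagonal (c : box) : bool := brow c == bcol c.

(* In the diagonal box (i, i), the letters 1, 2', 3, 4', ... if i is odd and
   1', 2, 3', 4, ... if i is even; here i = (brow c).+1 and |a| = a.1.+1. *)
Definition tableau' (T : filling) : bool :=
  tableau T &&
  [forall c, diagonal c ==>
    [forall a in T c,
       if odd (brow c).+1 then unprimed a == odd a.1.+1
       else unprimed a == ~~ odd a.1.+1]].

Definition tableau'' (T : filling) : bool :=
  tableau T && [forall c, diagonal c ==> [forall a in T c, unprimed a]].

Definition tab_size (T : filling) : nat := \sum_c #|T c|.

Variables (F : fieldType) (beta : F).

(* [bs k] is the parameter attached to the boxes with j - i = k: it is b_k for
   the weights of type I and b_(k+1) for those of type II. *)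
Definition box_weight (x : n.-tuple F) (bs : nat -> F) (c : box) (a : letter)
    : F :=
  if unprimed a then oplus beta (tnth x a.1) (bs (offset c))
  else ominus beta (tnth x a.1) (bs (offset c)).

Definition tab_weight (x : n.-tuple F) (bs : nat -> F) (T : filling) : F :=
  \prod_c \prod_(a in T c) box_weight x bs c a.

Definition weightI (x : n.-tuple F) (b : nat -> F) : filling -> F :=
  tab_weight x (cons0 b).
Definition weightII (x : n.-tuple F) (b : nat -> F) : filling -> F :=
  tab_weight x b.

End Tableaux.

(* Main.v *)
Require Import Defs.
From mathcomp Require Import boolp zify ring.
Import GRing.Theory.
Local Open Scope ring_scope.

Set Implicit Arguments.
Unset Strict Implicit.
Unset Printing Implicit Defensive.

(** Both sides satisfy the same branching rule in the number of variables, for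
    GP and GQ in any number n of variables (of either parity).

    Let t be the last variable, phi(x, y) = (x (+) y) / (x (-) y), let H_m be the
    factor of a part m and U(q, p) the product of t (+) b_k for q <= k < p. On the
    tableau side the letters n', n form a strip between a strict partition nu and
    mu, with mu_(i+1) <= nu_i <= mu_i, and the strip weight is a product over
    the rows, up to the constraint nu_(i+1) < mu_(i+1) on some fillings of row i.
    Since S_(.., q, q, ..) = - beta S_(.., q+1, q, ..) for the symmetrizations S,
    these constraints may be dropped. Each row sum then telescopes to
    H_p(x) phi(x, t) + H_q(x) phi(t, x) U(q, p) with p = mu_i, q = mu_(i+1).
    In the expanded product, a second term in row i followed by a first term in
    row i+1 is antisymmetric in x_i, x_(i+1); what survives is the expansion of
    S_mu(x_1, ..., x_n) according to the position of x_n = t. The last row, which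
    can lose its diagonal box, is treated by a partial fraction identity for
    sums of products of phi's. *)

(** * Partial fractions *)

(** The three formulas are treated together: [H] is any family of heads with H_(k+1)(z) = (z (+)
    bs_k) H_k(z) for k > 0, and [dg] tells which letters a diagonal box may hold. Off the diagonal
    the weights of N', of N and of both together add up to t (+) t whatever the parameter, so apart
    from [bs] a type shows only in H_1 and on the diagonal. In type D the diagonal identity depends
    on a parity, because the sum of the products of phi's over M points is 1 for M odd but - beta
    (y_1 (+) ... (+) y_M) for M even. The alternation of primed and unprimed diagonal letters comes
    from there.

    The obstacle is that the constraints tie each row to the next, so the sum over nu is no product
    of row sums. Without them nu may have equal parts and is no shifted shape; hence tableau sums
    are replaced by symmetrizations, which make sense for any sequence of parts, before the
    constraints are dropped.

    Set-valued boxes add a second coupling: N' or N may join the smaller letters in the last box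
    that these fill in a row. One Boolean per row records this and makes the boxes independent. *)

Section PartialFractions.
Variables (F : fieldType) (beta : F).
Implicit Types (y : nat -> F) (t z : F).
Local Notation "x [+] y" := (oplus beta x y) (at level 50).

(** [locked] keeps simplification and [field] from opening the quotient; [phiE] is the form with the
    single denominator x - z. *)
Definition phi (x z : F) : F := locked (oplus beta x z / ominus beta x z).

Lemma phiE (x z : F) : phi x z = (x [+] z) * (1 + beta * z) / (x - z).
Proof. by rewrite /phi -lock /ominus invf_div mulrA. Qed.

Lemma phi_def (x z : F) : oplus beta x z / ominus beta x z = phi x z.
Proof. by rewrite /phi -lock. Qed.

(** Variables are functions on nat of which the first M values count, so that inserting, swapping
    and splitting off a variable needs no casts. *)
Definition nondeg (M : nat) y : Prop :=
  (forall i j, (i < M)%N -> (j < M)%N -> i != j -> y i != y j) /\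
  (forall i, (i < M)%N -> 1 + beta * y i != 0).

Definition away (M : nat) y t : Prop := forall i, (i < M)%N -> t != y i.

Definition phiprod (M : nat) y (i : nat) : F :=
  \prod_(k < M | (k : nat) != i) phi (y i) (y k).

(** This is the symmetrization of one row with head f; for f = id it is GP of the partition (1) at b
    = 0. *)
Definition phisum (f : F -> F) (M : nat) y : F :=
  \sum_(i < M) f (y i) * phiprod M y i.

(** Factor by factor, (z (+) y)(1 + beta y) - (z - y) = (1 + beta z)(y (+) y). The difference of the
    products therefore telescopes into terms divisible by 1 + beta z, with quotients of degree less
    than M. *)
Lemma telescoping_poly (M : nat) y :
  exists q : {poly F}, (size q <= M)%N /\
    forall z, (1 + beta * z) * q.[z] =
      \prod_(k < M) ((z [+] y k) * (1 + beta * y k)) - \prod_(k < M) (z - y k).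
Proof.
elim: M => [|M [q [qs qE]]].
  by exists 0; rewrite size_poly0; split=> // z; rewrite !big_ord0 horner0 mulr0 subrr.
pose a k : {poly F} := (1 + beta * y k) *: ((1 + beta * y k) *: 'X + (y k)%:P).
have aE k z : (a k).[z] = (z [+] y k) * (1 + beta * y k).
  by rewrite /a !hornerE /oplus; ring.
have as2 k : (size (a k) <= 2)%N.
  apply: (leq_trans (size_scale_leq _ _)); apply: (leq_trans (size_polyD _ _)).
  rewrite geq_max (leq_trans (size_scale_leq _ _)) ?size_polyX //.
  by rewrite (leq_trans (size_polyC_leq1 _)).
have pas : (size (\prod_(k < M) a k)%R <= M.+1)%N.
  elim: (M) => [|m IH]; first by rewrite big_ord0 size_poly1.
  rewrite big_ord_recr /=; apply: (leq_trans (size_polyMleq _ _)).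
  by rewrite -subn1 leq_subLR (leq_trans (leq_add IH (as2 m))) //; lia.
exists (q * ('X - (y M)%:P) + (y M [+] y M) *: \prod_(k < M) a k); split.
  apply: (leq_trans (size_polyD _ _)); rewrite geq_max; apply/andP; split.
    by apply: (leq_trans (size_polyMleq _ _)); rewrite size_XsubC; lia.
  exact: (leq_trans (size_scale_leq _ _)).
move=> z; rewrite !big_ord_recr /= !hornerE horner_prod.
under [X in _ * (_ + _ * X)]eq_bigr do rewrite aE.
have := qE z; move: q.[z] (\prod_(k < M) (_ * _)) (\prod_(k < M) (_ - _)) => Q A B E.
apply: (etrans (y := (A - B) * (z - y M) + (1 + beta * z) * ((y M [+] y M) * A))).
  rewrite -E; ring.
by rewrite /oplus /=; ring.
Qed.

Lemma phiprod_recr (M : nat) y i : (i < M)%N ->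
  phiprod M.+1 y i = phiprod M y i * phi (y i) (y M).
Proof.
move=> iM; rewrite /phiprod big_mkcond big_ord_recr /= -big_mkcond /=.
by rewrite neq_ltn iM orbT.
Qed.

Lemma phiprod_last (M : nat) y :
  phiprod M.+1 y M = \prod_(k < M) phi (y M) (y k).
Proof.
rewrite /phiprod big_mkcond big_ord_recr /= eqxx mulr1.
by apply: eq_bigr => i _; rewrite neq_ltn ltn_ord.
Qed.

(* Partial fraction expansion of the right-hand side as a function of [t]. *)
Lemma phi_partial_fractions (M : nat) y t : nondeg M y -> away M y t ->
  \sum_(i < M) (phi t (y i) - 1) * phiprod M y i =
  \prod_(i < M) phi t (y i) - 1.
Proof.
move=> [yI yN] yt.
have [q [qs qE]] := telescoping_poly M y.
pose c (i : 'I_M) : {poly F} := \prod_(k < M | k != i) ('X - (y k)%:P).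
(* [Q] is q minus its Lagrange interpolant at the y_i: at y_j the product of the z - y_k vanishes
   and [qE] determines q(y_j) after cancelling 1 + beta y_j. Having M distinct roots and size at
   most M, [Q] is zero. *)
pose Q := q - \sum_(i < M) ((y i [+] y i) * phiprod M y i) *: c i.
have QE z : Q.[z] = q.[z] - \sum_(i < M) ((y i [+] y i) * phiprod M y i) *
    \prod_(k < M | k != i) (z - y k).
  rewrite /Q !hornerE horner_sum; congr (_ - _); apply: eq_bigr => i _.
  rewrite hornerZ horner_prod; congr (_ * _); apply: eq_bigr => k _.
  by rewrite !hornerE.
have Q0 : Q = 0.
  apply: (@roots_geq_poly_eq0 _ Q [seq y i | i : 'I_M]).
  - apply/allP=> _ /mapP[j _ ->]; have S0 : \sum_(i < M | i != j) ((y i [+] y i) * phiprod M y i) *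
          \prod_(k < M | k != i) (y j - y k) = 0.
        apply: big1 => i ij.
        by rewrite (bigD1 j) 1?eq_sym //= subrr mul0r mulr0.
      rewrite rootE QE (bigD1 j) //= S0 addr0.
      apply/eqP; apply: (mulfI (yN j (ltn_ord j))).
      rewrite mulr0 mulrBr qE (bigD1 j) //= (bigD1 (P := xpredT) j) //= subrr.
      rewrite mul0r subr0 /phiprod.
      have -> : \prod_(i < M | i != j) ((y j [+] y i) * (1 + beta * y i)) =
          (\prod_(k < M | (k : nat) != j) phi (y j) (y k)) *
          \prod_(k < M | k != j) (y j - y k).
        rewrite -big_split /=; apply: eq_bigr => k kj.
        by rewrite phiE divfK // subr_eq0; apply: yI; rewrite // eq_sym.
      rewrite /=; set A := \prod_(k < M | _) _; set B := \prod_(k < M | _) _; ring.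
  - rewrite map_inj_in_uniq ?enum_uniq // => i j _ _ yij.
    apply/eqP/negPn/negP=> nij; move/eqP: yij.
    by apply/negP; apply: yI.
  - rewrite size_map -cardE card_ord; apply: (leq_trans (size_polyD _ _)).
    rewrite geq_max qs size_polyN; apply: (leq_trans (size_sum _ _ _)).
    apply/bigmax_leqP=> i _; apply: (leq_trans (size_scale_leq _ _)).
    rewrite /c -big_filter size_prod_XsubC.
    have -> : size [seq k <- index_enum 'I_M | k != i] = M.-1.
      by rewrite -sum1_size big_filter -[M in RHS]card_ord -(cardC1 i) -sum1_card.
    by case: (M) i => // - [].
have := QE t; rewrite Q0 horner0 => /esym/(congr1 ( *%R (1 + beta * t))).
rewrite mulr0 mulrBr qE => tE.
pose P := \prod_(k < M) (t - y k).
have P0 : P != 0 by apply/prodf_neq0 => k _; rewrite subr_eq0; exact: yt.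
apply: (mulfI P0); rewrite mulrBr -big_split /= mulr1.
have -> : \prod_(i < M) ((t - y i) * phi t (y i)) =
          \prod_(k < M) ((t [+] y k) * (1 + beta * y k)).
  by apply: eq_bigr => k _; rewrite phiE mulrC divfK // subr_eq0; exact: yt.
(* Termwise, phi(t, y) - 1 = (1 + beta t)(y (+) y) / (t - y). *)
move/subr0_eq: tE => ->; rewrite !mulr_sumr; apply: eq_bigr => i _.
rewrite /P (bigD1 i) //= phiE /oplus; field.
by rewrite subr_eq0; exact: yt.
Qed.

Lemma nondeg_leq (M M' : nat) y : (M <= M')%N -> nondeg M' y -> nondeg M y.
Proof.
move=> le [h1 h2]; split=> [i j iM jM|i iM]; [apply: h1|apply: h2];
  exact: leq_trans le.
Qed.

Lemma nondeg_away (M : nat) y : nondeg M.+1 y -> away M y (y M).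
Proof. by move=> [h _] i iM; apply: h; [|exact: ltnW|rewrite gtn_eqF]. Qed.

Lemma phisum_recr f (M : nat) y : phisum f M.+1 y =
  f (y M) * \prod_(k < M) phi (y M) (y k) +
  \sum_(i < M) f (y i) * phi (y i) (y M) * phiprod M y i.
Proof.
rewrite /phisum big_ord_recr /= phiprod_last addrC; congr (_ + _).
by apply: eq_bigr => i _; rewrite phiprod_recr // mulrA mulrAC.
Qed.

(** The identity y phi(y, t) = (1 + beta t) y - t (phi(t, y) - 1) reduces the sum to
    [phi_partial_fractions]. Iterated, it shows that [phisum id M y] is the formal sum y_0 (+) ...
    (+) y_(M-1). *)
Lemma phisum_id_recr (M : nat) y : nondeg M.+1 y ->
  phisum id M.+1 y = y M [+] phisum id M y.
Proof.
move=> yn; have yM := nondeg_leq (leqnSn M) yn; have ya := nondeg_away yn.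
have I := phi_partial_fractions yM ya.
rewrite phisum_recr; set t := y M in ya I *.
have -> : \sum_(i < M) y i * phi (y i) t * phiprod M y i =
  \sum_(i < M) (- t * ((phi t (y i) - 1) * phiprod M y i)
      + (1 + beta * t) * (y i * phiprod M y i)).
  apply: eq_bigr => i _; rewrite !phiE /oplus.
  have h : t - y i != 0 by rewrite subr_eq0; exact: ya.
  have h' : y i - t != 0 by rewrite -opprB oppr_eq0.
  by field; rewrite h h'.
rewrite [X in _ + X]big_split /= -!mulr_sumr I /oplus /phisum; ring.
Qed.

(** The same method, with phi(y, t) + (phi(t, y) - 1) = - (1 + beta t)(1 + beta y). *)
Lemma phisum_one_recr (M : nat) y : nondeg M.+1 y ->
  phisum (fun=> 1) M.+1 y =
  1 - (1 + beta * y M) * (phisum (fun=> 1) M y + beta * phisum id M y).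
Proof.
move=> yn; have yM := nondeg_leq (leqnSn M) yn; have ya := nondeg_away yn.
have I := phi_partial_fractions yM ya.
rewrite phisum_recr; set t := y M in ya I *.
have -> : \sum_(i < M) 1 * phi (y i) t * phiprod M y i =
  \sum_(i < M) (- ((phi t (y i) - 1) * phiprod M y i)
    - (1 + beta * t) * (1 * phiprod M y i + beta * (y i * phiprod M y i))).
  apply: eq_bigr => i _; rewrite !phiE /oplus.
  have h : t - y i != 0 by rewrite subr_eq0; exact: ya.
  have h' : y i - t != 0 by rewrite -opprB oppr_eq0.
  by field; rewrite h h'.
rewrite [X in _ + X]big_split /= !sumrN -mulr_sumr I.
rewrite [X in (1 + beta * t) * X]big_split /= -!mulr_sumr /phisum -!mulr_sumr; ring.
Qed.

(** Writing e_M for [phisum id M y], one has 1 + beta e_(M+1) = (1 + beta y_M)(1 + beta e_M), so the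
    recursion for the constant 1 alternates between the two values. *)
Lemma phisum_one_parity (M : nat) y : nondeg M y ->
  phisum (fun=> 1) M y = if odd M then 1 else - beta * phisum id M y.
Proof.
elim: M => [|M IH] yn; first by rewrite /phisum !big_ord0 mulr0.
rewrite phisum_one_recr // phisum_id_recr // (IH (nondeg_leq (leqnSn M) yn)) /=.
by case: (odd M); rewrite /oplus; ring.
Qed.

(* The only condition that depends on the type, through the head [h] of a part 1
   and the weight [om] of the letters of a single variable in a diagonal box. *)
Definition diag_id (h : F -> F) (om : F) (M : nat) y t : Prop :=
  \sum_(i < M) h (y i) * (1 + beta * om - phi (y i) t) * phiprod M y i + om =
  h t * \prod_(i < M) phi t (y i).

(** In types B and C the diagonal weight is h(t) for every M, and each term of the sum is h(t) times
    a term of [phi_partial_fractions]. *)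
Lemma diag_id_simple (h : F -> F) (M : nat) y t : nondeg M y -> away M y t ->
  (forall z, z != t ->
     h z * (1 + beta * h t - phi z t) = h t * (phi t z - 1)) ->
  diag_id h (h t) M y t.
Proof.
move=> yn ya hE; rewrite /diag_id.
have -> : \sum_(i < M) h (y i) * (1 + beta * h t - phi (y i) t) * phiprod M y i
   = h t * \sum_(i < M) (phi t (y i) - 1) * phiprod M y i.
  rewrite mulr_sumr; apply: eq_bigr => i _.
  by rewrite hE ?mulrA // eq_sym; exact: ya.
rewrite phi_partial_fractions //; ring.
Qed.

Lemma diag_idB (M : nat) y t : nondeg M y -> away M y t -> diag_id id t M y t.
Proof.
move=> yn ya; apply: diag_id_simple => // z zt; rewrite !phiE /oplus.
have h : z - t != 0 by rewrite subr_eq0.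
have h' : t - z != 0 by rewrite -opprB oppr_eq0.
by field; rewrite h h'.
Qed.

Lemma diag_idC (M : nat) y t : nondeg M y -> away M y t ->
  diag_id (fun z => z [+] z) (t [+] t) M y t.
Proof.
move=> yn ya; apply: (@diag_id_simple (fun z => z [+] z)) => // z zt; rewrite !phiE /oplus.
have h : z - t != 0 by rewrite subr_eq0.
have h' : t - z != 0 by rewrite -opprB oppr_eq0.
by field; rewrite h h'.
Qed.

(** The head is affine, y (+) b = (1 + beta b) y + b, so only sums for 1 and id occur, with or
    without the factor phi(y_i, t). Those with this factor are read off from [phisum_recr] for the
    points y_0, ..., y_(M-1), t; as M and M + 1 differ in parity, the result switches between t (+)
    b and t (-) b. *)
Lemma diag_idD (b : F) (M : nat) y t : nondeg M y -> away M y t ->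
  1 + beta * t != 0 -> 1 + beta * b != 0 ->
  diag_id (fun z => z [+] b) (if odd M then ominus beta t b else t [+] b) M y t.
Proof.
move=> yn ya t0 b0; rewrite /diag_id.
pose y' k := if k == M then t else y k.
have y'E k : (k < M)%N -> y' k = y k by rewrite /y'; case: eqP => // ->; rewrite ltnn.
have y'M : y' M = t by rewrite /y' eqxx.
have yn' : nondeg M.+1 y'.
  case: yn => h1 h2; split=> [i j|i]; rewrite !ltnS /y'.
    case: (eqVneq i M) => [->|iM]; case: (eqVneq j M) => [->|jM] //; rewrite ?eqxx // => *.
    - by apply: ya; lia.
    - by rewrite eq_sym; apply: ya; lia.
    - by apply: h1; lia.
  by case: (eqVneq i M) => // iM iM'; apply: h2; lia.
set om := (if odd M then _ else _).
have pE i : (i < M)%N -> phiprod M y' i = phiprod M y i.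
  by move=> iM; apply: eq_bigr => k _; rewrite !y'E.
have sE f : phisum f M y' = phisum f M y.
  by apply: eq_bigr => i _; rewrite pE // y'E.
have I1 := phisum_one_parity yn'; have e1 := phisum_id_recr yn'.
have I0 := phisum_one_parity yn.
rewrite e1 !sE y'M in I1.
have R1 := phisum_recr (fun=> 1) M y'; have Re := phisum_recr id M y'.
rewrite I1 y'M in R1; rewrite e1 !sE y'M in Re.
pose P := \prod_(i < M) phi t (y i).
have PE : \prod_(k < M) phi t (y' k) = P by apply: eq_bigr => i _; rewrite y'E.
pose s1 := \sum_(i < M) phi (y i) t * phiprod M y i.
pose se := \sum_(i < M) y i * phi (y i) t * phiprod M y i.
have s1E : \sum_(i < M) 1 * phi (y' i) t * phiprod M y' i = s1.
  by apply: eq_bigr => i _; rewrite y'E // pE // mul1r.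
have seE : \sum_(i < M) id (y' i) * phi (y' i) t * phiprod M y' i = se.
  by apply: eq_bigr => i _; rewrite y'E // pE.
rewrite PE s1E mul1r in R1; rewrite PE seE in Re.
have -> : \sum_(i < M) (y i [+] b) * (1 + beta * om - phi (y i) t) * phiprod M y i
  = (1 + beta * om) * ((1 + beta * b) * phisum id M y + b * phisum (fun=> 1) M y)
    - (1 + beta * b) * se - b * s1.
  rewrite /phisum /se /s1 !mulr_sumr -big_split /= mulr_sumr -!sumrB.
  by apply: eq_bigr => i _; rewrite /oplus; ring.
have -> : se = (t [+] phisum id M y) - t * P by rewrite Re /= addrC addKr.
have -> : s1 = (if odd M.+1 then 1 else - beta * (t [+] phisum id M y)) - P.
  by rewrite R1 addrC addKr.
rewrite I0 -/P /om /=.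
by case: (odd M); rewrite /oplus /ominus /=; field.
Qed.

End PartialFractions.

(** * Symmetrization *)

Definition swapn (a b k : nat) : nat :=
  if k == a then b else if k == b then a else k.

Lemma swapnK a b : involutive (swapn a b).
Proof.
move=> k; rewrite /swapn.
case: (eqVneq k a) => [->|ka]; first by case: eqVneq; rewrite ?eqxx.
case: (eqVneq k b) => [->|kb]; first by rewrite eqxx.
by rewrite (negPf ka) (negPf kb).
Qed.

Lemma swapn_id a b k : k != a -> k != b -> swapn a b k = k.
Proof. by rewrite /swapn => /negPf-> /negPf->. Qed.

Lemma swapn_l a b : swapn a b a = b.
Proof. by rewrite /swapn eqxx. Qed.

Lemma swapn_r a b : swapn a b b = a.
Proof. by rewrite /swapn eqxx; case: eqVneq. Qed.

Lemma big_swapn (R : Type) (idx : R) (op : Monoid.com_law idx) (m n a b : nat)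
    (P : pred nat) (g : nat -> R) :
  (m <= a < n)%N -> (m <= b < n)%N ->
  \big[op/idx]_(m <= j < n | P (swapn a b j)) g (swapn a b j) =
  \big[op/idx]_(m <= j < n | P j) g j.
Proof.
move=> ha hb.
rewrite -(@big_map _ _ _ _ _ (swapn a b) (index_iota m n) P g).
apply: perm_big; apply: uniq_perm; rewrite ?iota_uniq //.
  by rewrite map_inj_uniq ?iota_uniq //; exact: inv_inj (@swapnK a b).
move=> k; rewrite -{1}(swapnK a b k) mem_map; last exact: inv_inj (@swapnK a b).
rewrite !mem_index_iota /swapn.
by case: (eqVneq k a) => [->|_]; [|case: (eqVneq k b) => [->|_]]; rewrite ?ha ?hb.
Qed.

Section Symmetrization.
Variables (F : fieldType) (beta : F).
Implicit Types (y x : nat -> F).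
Local Notation phi := (phi beta).
Local Notation nondeg := (nondeg beta).

(** The value 0 outside the range is unaffected by swaps and insertions inside it, so the lemmas
    below are equalities of functions on nat. *)
Definition act (N : nat) (w : 'S_N) x : nat -> F :=
  fun k => oapp (fun i : 'I_N => x (w i)) 0 (insub k).

Lemma actE N (w : 'S_N) x (i : 'I_N) : act w x i = x (w i).
Proof. by rewrite /act valK. Qed.

Lemma act_out N (w : 'S_N) x k : (N <= k)%N -> act w x k = 0.
Proof. by move=> h; rewrite /act insubN // -leqNgt. Qed.

Lemma nondeg_act N (w : 'S_N) x : nondeg N x -> nondeg N (act w x).
Proof.
move=> [h1 h2]; split=> [i j iN jN ij|i iN].
  rewrite (actE w x (Ordinal iN)) (actE w x (Ordinal jN)); apply: h1 => //.
  by rewrite (inj_eq val_inj) (inj_eq perm_inj).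
by rewrite (actE w x (Ordinal iN)); apply: h2.
Qed.

Lemma away_act N (w : 'S_N) x t : away N x t -> away N (act w x) t.
Proof. by move=> h i iN; rewrite (actE w x (Ordinal iN)); apply: h. Qed.

Definition Sym (N : nat) (G : (nat -> F) -> F) x : F :=
  \sum_(w : 'S_N) G (act w x).

Lemma eq_Sym N G G' x : (forall w : 'S_N, G (act w x) = G' (act w x)) ->
  Sym N G x = Sym N G' x.
Proof. by move=> h; apply: eq_bigr. Qed.

Lemma SymD N G G' x : Sym N (fun y => G y + G' y) x = Sym N G x + Sym N G' x.
Proof. exact: big_split. Qed.

Lemma SymZ N c G x : Sym N (fun y => c * G y) x = c * Sym N G x.
Proof. by rewrite /Sym mulr_sumr. Qed.

Lemma Sym_swap N (a b : nat) G x : (a < N)%N -> (b < N)%N ->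
  Sym N (fun y => G (fun k => y (swapn a b k))) x = Sym N G x.
Proof.
move=> aN bN; pose s := tperm (Ordinal aN) (Ordinal bN).
rewrite [RHS]/Sym (reindex_inj (mulgI s)); apply: eq_bigr => w _; congr (G _).
apply/funext => k; case: (ltnP k N) => kN; last first.
  by rewrite swapn_id ?gtn_eqF ?act_out //; [exact: leq_trans kN|exact: leq_trans kN].
rewrite (actE _ _ (Ordinal kN)) permM.
have -> : swapn a b k = s (Ordinal kN).
  rewrite /s /swapn; case: tpermP => [[->]|[->]|]; rewrite ?eqxx //.
    by case: eqVneq.
  move=> /eqP; rewrite -(inj_eq val_inj) => /negPf /= -> /eqP.
  by rewrite -(inj_eq val_inj) => /negPf /= ->.
by rewrite actE.
Qed.

Definition Phi (l N : nat) y : F :=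
  \prod_(0 <= i < l) \prod_(i.+1 <= j < N) phi (y i) (y j).

Lemma Phi_swap_tail (l N a b : nat) y : (l <= a < N)%N -> (l <= b < N)%N ->
  Phi l N (fun k => y (swapn a b k)) = Phi l N y.
Proof.
move=> ha hb; apply: eq_big_nat => i il.
rewrite swapn_id; try lia.
by apply: (@big_swapn _ _ _ i.+1 N a b xpredT (fun j => phi (y i) (y j))); lia.
Qed.

(** The swap permutes all factors among themselves except phi(y_k, y_(k+1)). *)
Lemma Phi_swap_adj (l N k : nat) y : (k.+1 < l)%N -> (l <= N)%N ->
  exists c, Phi l N y = phi (y k) (y k.+1) * c /\
    Phi l N (fun i => y (swapn k k.+1 i)) = phi (y k.+1) (y k) * c.
Proof.
move=> kl lN; rewrite /Phi.
rewrite !(@big_cat_nat _ _ _ k 0 l) /=; try lia.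
rewrite !(@big_ltn _ _ _ k l); try lia.
rewrite !(@big_ltn _ _ _ k.+1 l); try lia.
rewrite !(@big_ltn _ _ _ k.+1 N); try lia.
rewrite swapn_l swapn_r.
have -> : \prod_(0 <= i < k) \prod_(i.+1 <= j < N)
    phi (y (swapn k k.+1 i)) (y (swapn k k.+1 j)) =
    \prod_(0 <= i < k) \prod_(i.+1 <= j < N) phi (y i) (y j).
  by apply: (@Phi_swap_tail k N k k.+1 y); lia.
have -> : \prod_(k.+2 <= i < l) \prod_(i.+1 <= j < N)
    phi (y (swapn k k.+1 i)) (y (swapn k k.+1 j)) =
    \prod_(k.+2 <= i < l) \prod_(i.+1 <= j < N) phi (y i) (y j).
  apply: eq_big_nat => i ki; apply: eq_big_nat => j ij.
  by rewrite !swapn_id //; lia.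
have row z : \prod_(k.+2 <= j < N) phi z (y (swapn k k.+1 j)) =
    \prod_(k.+2 <= j < N) phi z (y j).
  by apply: eq_big_nat => j ij; rewrite swapn_id //; lia.
rewrite !row.
move: (\prod_(0 <= i < k) _) (\prod_(k.+2 <= j < N) phi (y k) _)
  (\prod_(k.+2 <= j < N) phi (y k.+1) _) (\prod_(k.+2 <= i < l) _) => a b c d.
by exists (a * b * c * d); split; ring.
Qed.

Hypothesis two0 : (2 : F) != 0.

(** Adding to the sum its image under the swap of k and k + 1 doubles it, while the summands then
    cancel for each w; 2 is invertible. *)
Lemma Sym_kill (l N k : nat) (P : (nat -> F) -> F) x :
  (k.+1 < l)%N -> (l <= N)%N ->
  (forall w : 'S_N, let y := act w x in
    P y * phi (y k) (y k.+1)
    + P (fun i => y (swapn k k.+1 i)) * phi (y k.+1) (y k) = 0) ->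
  Sym N (fun y => P y * Phi l N y) x = 0.
Proof.
move=> kl lN hP; apply: (mulfI two0); rewrite mulr0.
have -> : (2 : F) = 1 + 1 by [].
rewrite mulrDl mul1r.
rewrite -{2}(@Sym_swap N k k.+1); try lia.
rewrite -SymD; apply: big1 => w _.
have := hP w; set y := act w x => /= hw.
have [c [-> ->]] := @Phi_swap_adj l N k y kl lN.
by rewrite !mulrA -mulrDl hw mul0r.
Qed.

(** All but the factors of row a is symmetric in the variables from position a on. Moving any of
    these N - a variables to position a thus gives the same sum, and adding the results produces the
    sums of products of phi's of the partial fraction identities. *)
Lemma Sym_tail (a N : nat) (Psi : (nat -> F) -> F) (c : F -> F) x :
  (a <= N)%N ->
  (forall y i, (a <= i < N)%N -> Psi (fun k => y (swapn a i k)) = Psi y) ->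
  (N - a)%:R * Sym N (fun y => Psi y * c (y a) * Phi a.+1 N y) x =
  Sym N (fun y => Psi y * Phi a N y * \sum_(a <= i < N) c (y i) *
     \prod_(a <= k < N | k != i) phi (y i) (y k)) x.
Proof.
move=> aN PsiE.
transitivity (\sum_(a <= i < N) Sym N (fun y => Psi y * Phi a N y * (c (y i) *
     \prod_(a <= k < N | k != i) phi (y i) (y k))) x); last first.
  by rewrite /Sym exchange_big /=; apply: eq_bigr => w _; rewrite mulr_sumr.
rewrite mulr_natl -[in LHS]sumr_const_nat; apply: eq_big_nat => i ai.
rewrite -(@Sym_swap N a i); try lia.
apply: eq_Sym => w; set y := act w x.
rewrite PsiE // -!mulrA; congr (_ * _).
rewrite swapn_l mulrCA; congr (_ * _).
have -> : forall z, Phi a.+1 N z = Phi a N z * \prod_(a.+1 <= j < N) phi (z a) (z j).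
  by move=> z; rewrite /Phi big_nat_recr.
rewrite Phi_swap_tail; try lia.
congr (_ * _); rewrite swapn_l.
rewrite -(@big_swapn _ _ _ a N a i (fun k => k != i) (fun k => phi (y i) (y k))); try lia.
rewrite [RHS]big_ltn_cond; last lia.
rewrite swapn_l eqxx /=.
rewrite big_nat_cond [RHS]big_nat_cond; apply: eq_bigl => k.
rewrite -[X in _ != X](swapn_l a i) (inj_eq (inv_inj (@swapnK a i))).
by case: (eqVneq k a) => [->|]; rewrite ?ltnn ?andbF ?andbT.
Qed.

End Symmetrization.

(** * Inserting the last variable *)

Lemma lift_perm_pair_bij (n : nat) :
  bijective (fun p : 'I_n.+1 * 'S_n => lift_perm p.1 ord_max p.2).
Proof.
apply: inj_card_bij; last by rewrite card_prod card_ord !card_Sn factS.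
move=> [i s] [j t] /= est.
have eij : i = j.
  have := lift_perm_id i ord_max s; rewrite est -[RHS](lift_perm_id j ord_max t).
  exact: perm_inj.
subst j; congr (_, _); apply/permP => k; apply: (@lift_inj _ ord_max).
by rewrite -(lift_perm_lift i) est lift_perm_lift.
Qed.

Section Branching.
Variables (F : fieldType) (beta : F).
Implicit Types (y x : nat -> F).
Local Notation phi := (phi beta).
Local Notation nondeg := (nondeg beta).
Local Notation Phi := (Phi beta).

Definition ins (j : nat) (t : F) y (k : nat) : F :=
  if (k < j)%N then y k else if k == j then t else y k.-1.

Lemma ins_lt j t y k : (k < j)%N -> ins j t y k = y k.
Proof. by rewrite /ins => ->. Qed.

Lemma ins_eq j t y : ins j t y j = t.
Proof. by rewrite /ins ltnn eqxx. Qed.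

Lemma ins_gt j t y k : (j <= k)%N -> ins j t y k.+1 = y k.
Proof.
move=> jk; rewrite /ins (_ : (k.+1 < j)%N = false); last by lia.
by rewrite (_ : (k.+1 == j) = false); last by lia.
Qed.

(** The permutations of N + 1 variables are sorted by the position j at which the last variable
    lands. *)
Lemma Sym_insert (N : nat) (G : (nat -> F) -> F) x :
  Sym N.+1 G x = \sum_(0 <= j < N.+1) Sym N (fun y => G (ins j (x N) y)) x.
Proof.
rewrite [LHS]/Sym.
have [g gK Kg] := lift_perm_pair_bij N.
rewrite (reindex (fun p : 'I_N.+1 * 'S_N => lift_perm p.1 ord_max p.2)); last first.
  by exists g => p _; [exact: gK | exact: Kg].
rewrite big_mkord /Sym pair_big /=; apply: eq_bigr => -[j s] _ /=.
congr (G _); apply/funext => k; rewrite /ins.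
case: (ltnP k N.+1) => kN; last first.
  rewrite act_out //; have jN := ltn_ord j.
  have -> : (k < j)%N = false by lia.
  have -> : (k == j) = false by lia.
  by rewrite act_out //; lia.
rewrite (actE _ _ (Ordinal kN)).
case: (unliftP j (Ordinal kN)) => [k' ek|ek]; rewrite ek.
  have -> : k = bump j k' by case: ek.
  rewrite lift_perm_lift lift_max /bump.
  case: (leqP j k') => jk; rewrite ?add1n ?add0n.
    by rewrite ltnNge ltnW ?ltnS //= gtn_eqF ?ltnS // actE.
  by rewrite jk actE.
have -> : k = j by rewrite -ek.
by rewrite lift_perm_id ltnn eqxx.
Qed.

Lemma prod_row_ins (f : F -> F) (m j N : nat) t y : (m <= j <= N)%N ->
  \prod_(m <= k < N.+1) f (ins j t y k) = f t * \prod_(m <= k < N) f (y k).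
Proof.
move=> /andP[mj jN].
rewrite (@big_cat_nat _ _ _ j m N.+1) //=; last by rewrite (leq_trans jN).
rewrite [X in _ * X]big_ltn ?ltnS // ins_eq mulrCA; congr (_ * _).
rewrite [RHS](@big_cat_nat _ _ _ j m N) //=; congr (_ * _).
  by apply: eq_big_nat => k /andP[_ kj]; rewrite /ins kj.
rewrite big_add1; apply: eq_big_nat => k /andP[jk _].
by rewrite ins_gt.
Qed.

Lemma Phi_ins_ge (l j N : nat) t y : (l <= j <= N)%N ->
  Phi l N.+1 (ins j t y) = (\prod_(0 <= i < l) phi (y i) t) * Phi l N y.
Proof.
move=> /andP[lj jN]; rewrite /Phi -big_split; apply: eq_big_nat => i /andP[_ il] /=.
rewrite -(@prod_row_ins (phi (y i)) i.+1 j); last by rewrite jN (leq_trans il).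
by rewrite (ins_lt _ _ (leq_trans il lj)).
Qed.

(** For j <= l the inserted t occupies one of the l + 1 rows, which leaves l rows to the other
    variables. *)
Lemma Phi_ins_lt (l j N : nat) t y : (j <= l)%N -> (l <= N)%N ->
  Phi l.+1 N.+1 (ins j t y) =
  (\prod_(0 <= i < j) phi (y i) t) * (\prod_(j <= i < N) phi t (y i)) * Phi l N y.
Proof.
move=> jl lN; rewrite {1}/Phi (@big_cat_nat _ _ _ j 0 l.+1) //=; last by lia.
rewrite -/(Phi j N.+1 (ins j t y)) Phi_ins_ge; last lia.
rewrite -!mulrA; congr (_ * _).
rewrite big_ltn ?ltnS // ins_eq.
rewrite [Phi l N y](@big_cat_nat _ _ _ j 0 l) //= -/(Phi j N y).
rewrite mulrCA; congr (_ * (_ * _)).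
  rewrite big_add1 /=; apply: eq_big_nat => k /andP[jk _].
  by rewrite ins_gt.
rewrite big_add1; apply: eq_big_nat => i /andP[ji _].
rewrite ins_gt //.
rewrite big_add1 /=; apply: eq_big_nat => k /andP[ik _].
by rewrite ins_gt //; lia.
Qed.

Hypothesis two0 : (2 : F) != 0.

Section OneVariable.
Variables (N a : nat) (x : nat -> F) (H : nat -> F -> F) (mu : nat -> nat).
Variable U : nat -> F.
Hypothesis (xn : nondeg N.+1 x) (aN : (a <= N)%N).
Let t := x N.

(** [A i] belongs to the terms in which t stands behind position i, [C i] to those in which t stands
    at or before it, so that y_i takes the part mu_(i+1). *)
Let A (i : nat) (z : F) : F := H (mu i) z * phi z t.
Let C (i : nat) (z : F) : F := H (mu i.+1) z * phi t z * U i.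

(** After clearing, the numerator is symmetric in z and z', whereas (t - z)(z' - t)(z - z') changes
    sign. *)
Lemma phi_triple_antisym (z z' : F) : t != z -> t != z' -> z != z' ->
  phi t z * phi z' t * phi z z' + phi t z' * phi z t * phi z' z = 0.
Proof.
move=> tz tz' zz'; rewrite !phiE /oplus.
have h1 : t - z != 0 by rewrite subr_eq0.
have h1' : z - t != 0 by rewrite -opprB oppr_eq0.
have h2 : t - z' != 0 by rewrite subr_eq0.
have h2' : z' - t != 0 by rewrite -opprB oppr_eq0.
have h3 : z - z' != 0 by rewrite subr_eq0.
have h3' : z' - z != 0 by rewrite -opprB oppr_eq0.
by field; rewrite h1 h1' h2 h2' h3 h3'.
Qed.

(** In C_k(y_k) A_(k+1)(y_(k+1)) both variables carry the head of mu_(k+1), so [phi_triple_antisym]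
    kills the term. An [A] in row m therefore forces an [A] in every row above, one row at a
    time. *)
Lemma Sym_drop_C (m l : nat) (Y : (nat -> F) -> F) :
  (m < l)%N -> (l <= N)%N ->
  (forall y k, (k < m)%N -> Y (fun i => y (swapn k k.+1 i)) = Y y) ->
  Sym N (fun y => (\prod_(0 <= i < m) (A i (y i) + C i (y i))) * A m (y m) *
                  Y y * Phi l N y) x =
  Sym N (fun y => (\prod_(0 <= i < m.+1) A i (y i)) * Y y * Phi l N y) x.
Proof.
move=> ml lN YE.
suff h k : (k <= m)%N ->
  Sym N (fun y => (\prod_(0 <= i < k) (A i (y i) + C i (y i))) *
     (\prod_(k <= i < m.+1) A i (y i)) * Y y * Phi l N y) x =
  Sym N (fun y => (\prod_(0 <= i < m.+1) A i (y i)) * Y y * Phi l N y) x.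
  rewrite -(h m) //; apply: eq_Sym => w.
  by rewrite big_nat1.
elim: k => [|k IH] km.
  by apply: eq_Sym => w; rewrite big_geq // mul1r.
rewrite -IH; last exact: ltnW.
rewrite -[RHS]addr0.
pose P y := (\prod_(0 <= i < k) (A i (y i) + C i (y i))) * C k (y k) *
     (A k.+1 (y k.+1)) * (\prod_(k.+2 <= i < m.+1) A i (y i)) * Y y.
have -> : 0 = Sym N (fun y => P y * Phi l N y) x.
  apply/esym; apply: (@Sym_kill F beta two0 l N k) => //; first exact: leq_ltn_trans ml.
  move=> w; set y := act w x.
  have yn : nondeg N y by apply: nondeg_act; apply: nondeg_leq xn.
  have ya : away N y t by apply: away_act; apply: nondeg_away xn.
  rewrite /P /= YE // swapn_l swapn_r.
  have -> : \prod_(0 <= i < k) (A i (y (swapn k k.+1 i)) + C i (y (swapn k k.+1 i)))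
     = \prod_(0 <= i < k) (A i (y i) + C i (y i)).
    by apply: eq_big_nat => i ik; rewrite swapn_id //; lia.
  have -> : \prod_(k.+2 <= i < m.+1) A i (y (swapn k k.+1 i))
     = \prod_(k.+2 <= i < m.+1) A i (y i).
    by apply: eq_big_nat => i ik; rewrite swapn_id //; lia.
  have := @phi_triple_antisym (y k) (y k.+1); rewrite !ya; try lia.
  have -> : y k != y k.+1 by case: yn => h _; apply: h; lia.
  move=> /(_ isT isT isT) e; rewrite /A /C.
  set p1 := \prod_(0 <= i < k) _; set p2 := \prod_(k.+2 <= i < m.+1) _.
  rewrite -[RHS](mulr0 (p1 * p2 * Y y * H (mu k.+1) (y k) * H (mu k.+1) (y k.+1) * U k)) -e.
  ring.
rewrite -SymD; apply: eq_Sym => w; rewrite big_nat_recr //=.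
rewrite (@big_ltn _ _ _ k m.+1); last lia.
rewrite (@big_ltn _ _ _ k.+1 m.+1); last lia.
rewrite /P; ring.
Qed.

(** Induction on the last row: a [C] there is absorbed into [Y], an [A] forces all the rows
    above. *)
Lemma Sym_expand_AC (m l : nat) (Y : (nat -> F) -> F) :
  (m <= l)%N -> (l <= N)%N ->
  (forall y k, (k.+1 < m)%N -> Y (fun i => y (swapn k k.+1 i)) = Y y) ->
  Sym N (fun y => (\prod_(0 <= i < m) (A i (y i) + C i (y i))) *
                  Y y * Phi l N y) x =
  \sum_(0 <= j < m.+1)
    Sym N (fun y => (\prod_(0 <= i < j) A i (y i)) *
      (\prod_(j <= i < m) C i (y i)) * Y y * Phi l N y) x.
Proof.
elim: m Y => [|m IH] Y ml lN YE.
  by rewrite big_nat1; apply: eq_Sym => w; rewrite !big_geq // !mul1r.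
rewrite big_nat_recr //=.
pose Y' y := C m (y m) * Y y.
have Y'E y k : (k.+1 < m)%N -> Y' (fun i => y (swapn k k.+1 i)) = Y' y.
  move=> km; rewrite /Y' YE; last lia.
  by rewrite swapn_id //; apply/eqP; lia.
have e := IH Y' (ltnW ml) lN Y'E.
have -> : \sum_(0 <= j < m.+1)
    Sym N (fun y => (\prod_(0 <= i < j) A i (y i)) *
      (\prod_(j <= i < m.+1) C i (y i)) * Y y * Phi l N y) x =
  \sum_(0 <= j < m.+1)
    Sym N (fun y => (\prod_(0 <= i < j) A i (y i)) *
      (\prod_(j <= i < m) C i (y i)) * Y' y * Phi l N y) x.
  apply: eq_big_nat => j jm; apply: eq_Sym => w.
  by rewrite big_nat_recr //= /Y' !mulrA.
rewrite -e.
have -> : Sym N (fun y => (\prod_(0 <= i < m.+1) A i (y i)) *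
      (\prod_(m.+1 <= i < m.+1) C i (y i)) * Y y * Phi l N y) x =
   Sym N (fun y => (\prod_(0 <= i < m.+1) A i (y i)) * Y y * Phi l N y) x.
  by apply: eq_Sym => w; rewrite [X in _ * X * _ * _]big_geq // mulr1.
rewrite -Sym_drop_C // -SymD; apply: eq_Sym => w; rewrite big_nat_recr //= /Y'; ring.
Qed.

(* [Cl] replaces [C] in the last row; [W] is the weight of a last row that loses
   its diagonal box. *)
Lemma Sym_branching (Cl : F -> F) (W : F) :
  (forall w : 'S_N, let y := act w x in
     \sum_(a <= i < N) Cl (y i) * \prod_(a <= k < N | k != i) phi (y i) (y k) + W
     = H (mu a) t * \prod_(a <= i < N) phi t (y i)) ->
  (forall j, (j <= a)%N -> H (mu a) t * \prod_(j <= i < a) U i = H (mu j) t) ->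
  (N - a)%:R * Sym N (fun y => (\prod_(0 <= i < a) (A i (y i) + C i (y i))) *
      (A a (y a) + Cl (y a)) * Phi a.+1 N y) x +
  W * Sym N (fun y => (\prod_(0 <= i < a) (A i (y i) + C i (y i))) * Phi a N y) x =
  Sym N.+1 (fun y => (\prod_(0 <= i < a.+1) H (mu i) (y i)) * Phi a.+1 N.+1 y) x.
Proof.
move=> hCl hU.
pose R y := \prod_(0 <= i < a) (A i (y i) + C i (y i)).
have -> : Sym N (fun y => R y * (A a (y a) + Cl (y a)) * Phi a.+1 N y) x =
  Sym N (fun y => R y * A a (y a) * 1 * Phi a.+1 N y) x +
  Sym N (fun y => R y * Cl (y a) * Phi a.+1 N y) x.
  by rewrite -SymD; apply: eq_Sym => w; ring.
rewrite mulrDr Sym_tail //; last first.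
  move=> y i ai; apply: eq_big_nat => k ka; rewrite swapn_id //; lia.
rewrite -[W * _]SymZ -addrA -SymD.
pose Xi y := \prod_(a <= i < N) phi t (y i).
have -> : Sym N (fun y => R y * Phi a N y * (\sum_(a <= i < N) Cl (y i) *
     \prod_(a <= k < N | k != i) phi (y i) (y k)) + W * (R y * Phi a N y)) x
  = Sym N (fun y => R y * (H (mu a) t * Xi y) * Phi a N y) x.
  apply: eq_Sym => w; rewrite /Xi -hCl; ring.
rewrite (@Sym_expand_AC a a (fun y => H (mu a) t * Xi y)) //; last first.
  move=> y k km; congr (_ * _); apply: eq_big_nat => i ai.
  by rewrite swapn_id //; lia.
(* Position j <= a of t matches the term with [A] in the rows before j and [C] from j on, where
   H_(mu_a)(t) times the factors U_i is H_(mu_j)(t). Positions beyond a match the term with [A] in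
   every row. *)
rewrite Sym_insert (@big_cat_nat _ _ _ a.+1 0 N.+1) //= addrC; congr (_ + _).
  apply: eq_big_nat => j /andP[_ ja]; apply: eq_Sym => w; set y := act w x.
  rewrite Phi_ins_lt //.
  rewrite (@big_cat_nat _ _ _ j 0 a.+1) //=; last exact: ltnW.
  have -> : \prod_(0 <= i < j) H (mu i) (ins j (x N) y i) =
            \prod_(0 <= i < j) H (mu i) (y i).
    by apply: eq_big_nat => k /andP[_ kj]; rewrite /ins kj.
  rewrite (@big_ltn _ _ _ j a.+1) // ins_eq big_add1 /=.
  have -> : \prod_(j <= i < a) H (mu i.+1) (ins j (x N) y i.+1) =
            \prod_(j <= i < a) H (mu i.+1) (y i).
    apply: eq_big_nat => k /andP[jk _].
    by rewrite ins_gt.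
  rewrite /A /C /Xi -(hU j) // -/t !big_split /=.
  rewrite [\prod_(j <= i < N) _](@big_cat_nat _ _ _ a j N) //=.
  ring.
(* For a = N no position lies beyond a, and the factor N - a is 0. *)
case: (ltnP a N) => [aN'|Na]; last first.
  rewrite big_geq // (_ : N - a = 0)%N ?mul0r //; lia.
rewrite Sym_drop_C //.
have -> : (N - a = N.+1 - a.+1)%N by lia.
(* The N - a positions beyond a contribute equally: t enters only through phi(y_i, t) with i <=
   a. *)
rewrite mulr_natl -sumr_const_nat; apply: eq_big_nat => j aj; apply: eq_Sym => w.
set y := act w x; rewrite Phi_ins_ge; last lia.
have -> : \prod_(0 <= i < a.+1) H (mu i) (ins j (x N) y i) =
          \prod_(0 <= i < a.+1) H (mu i) (y i).
  by apply: eq_big_nat => k ka; rewrite ins_lt //; lia.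
by rewrite /A big_split /= mulr1 -/t !mulrA.
Qed.

End OneVariable.
End Branching.

(** * Row sums *)

Definition upd (I : finType) (J : Type) (f : {ffun I -> J}) (i : I) (j : J) :
  {ffun I -> J} := [ffun k => if k == i then j else f k].

Lemma sum_pair_cancel (V : nmodType) (I J : finType) (i : I) (a b : J)
    (f : {ffun I -> J} -> V) : a != b ->
  (forall g : {ffun I -> J}, g i != a -> g i != b -> f g = 0) ->
  (forall g : {ffun I -> J}, g i = a -> f g + f (upd g i b) = 0) ->
  \sum_g f g = 0.
Proof.
move=> ab f0 fab.
rewrite (bigID (fun g : {ffun I -> J} => g i == a)) /=.
rewrite [X in _ + X](bigID (fun g : {ffun I -> J} => g i == b)) /=.
rewrite [X in _ + (_ + X)]big1 ?addr0; last by move=> g /andP[]; exact: f0.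
rewrite [X in _ + X](reindex_onto (fun g => upd g i b) (fun g => upd g i a)) /=; last first.
  move=> g /andP[_ /eqP gb]; apply/ffunP => k; rewrite !ffunE.
  by case: eqVneq => // ->.
have -> : \sum_(g : {ffun I -> J} | (upd g i b i != a) && (upd g i b i == b) &&
    (upd (upd g i b) i a == g)) f (upd g i b) = \sum_(g : {ffun I -> J} | g i == a) f (upd g i b).
  apply: eq_bigl => g; rewrite !ffunE !eqxx eq_sym ab /=.
  apply/eqP/eqP => [<-|ga]; first by rewrite !ffunE eqxx.
  by apply/ffunP => k; rewrite !ffunE; case: eqVneq => // ->.
by rewrite -big_split; apply: big1 => g /eqP; exact: fab.
Qed.

Section RowSums.
Variables (F : fieldType) (beta : F) (bs : nat -> F) (t : F).
Hypothesis bs0 : forall k, 1 + beta * bs k != 0.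
Local Notation phi := (phi beta).
Local Notation "x [+] y" := (oplus beta x y) (at level 50).

(** Weights of the letters N and N' in a box of offset k. *)
Definition uw (k : nat) : F := t [+] bs k.
Definition vw (k : nat) : F := ominus beta t (bs k).
Definition U (a b : nat) : F := \prod_(a <= k < b) uw k.

Lemma U_recr a b : (a <= b)%N -> U a b.+1 = U a b * uw b.
Proof. by move=> ab; rewrite /U big_nat_recr. Qed.

Lemma U_recl a b : (a < b)%N -> U a b = uw a * U a.+1 b.
Proof. by move=> ab; rewrite /U big_ltn. Qed.

Lemma U_geq a b : (b <= a)%N -> U a b = 1.
Proof. by move=> ab; rewrite /U big_geq. Qed.

(* The total weight of the letters [N'] and [N] in a row of length [p] above a
   row of length [q], when the smaller letters fill [m] boxes of the row; [d]
   records that the smaller letters do not fill the whole lower row. *)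
Definition rowwt (p q m : nat) (d : bool) : F :=
  if (q <= m <= p)%N then
    let lam := if (q.+1 < m)%N then beta * (t [+] t)
               else if m == q.+1 then d%:R * (beta * vw q) else 0 in
    (if m == p then 1 + lam else
     if m == q then d%:R * vw q else (t [+] t) + lam * uw m) * U m.+1 p
  else 0.

(** The last row may lose its diagonal box (m = 0). [om] is the total weight of N', N or both in
    that box, and [lam] accounts for new letters joining the smaller ones in box m - 1. *)
Definition lastwt (om : F) (p m : nat) : F :=
  if (m <= p)%N then
    let lam := if (1 < m)%N then beta * (t [+] t) else beta * om in
    (if m == 0%N then om else
     if m == p then 1 + lam else (t [+] t) + lam * uw m) * U m.+1 p
  else 0.

Section Head.
Variable (H : nat -> F -> F).
Hypothesis HE : forall k z, (0 < k)%N -> H k.+1 z = (z [+] bs k) * H k z.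

(** As a function of p the row sum obeys a first-order linear recursion with multiplier [uw p].
    H_p(z) phi(z, t) is a particular solution and U(p0, p) solves the homogeneous recursion, with a
    coefficient fixed at p0. *)
Lemma row_sum_solve (w : nat -> nat -> F) (m0 p0 : nat) z :
  (0 < p0)%N -> (m0 <= p0)%N -> z != t ->
  (forall p m, (p0 <= p)%N -> (m0 <= m < p)%N -> w p.+1 m = w p m * uw p) ->
  (forall p, (p0 <= p)%N ->
     w p.+1 p = (t [+] t) + (w p p - 1) * uw p /\
     w p.+1 p.+1 = 1 + beta * (t [+] t)) ->
  forall p, (p0 <= p)%N ->
  \sum_(m0 <= m < p.+1) w p m * H m z =
  H p z * phi z t +
  (\sum_(m0 <= m < p0.+1) w p0 m * H m z - H p0 z * phi z t) * U p0 p.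
Proof.
move=> p00 m0p0 zt w1 w2 p; elim: p => [|p IH] p0p; first lia.
case: (ltngtP p0 p.+1) p0p => // [p0p _|<- _]; last first.
  by rewrite U_geq // mulr1 addrC subrK.
have {}p0p : (p0 <= p)%N by [].
have := IH p0p; have [w2a w2b] := w2 p p0p.
rewrite big_nat_recr /=; last by rewrite (leq_trans m0p0).
rewrite [\sum_(m0 <= m < p.+2) _]big_nat_recr /=; last by rewrite (leq_trans m0p0) // ltnW.
rewrite [\sum_(m0 <= m < p.+1) _]big_nat_recr /=; last by rewrite (leq_trans m0p0).
have -> : \sum_(m0 <= m < p) w p.+1 m * H m z = uw p * \sum_(m0 <= m < p) w p m * H m z.
  by rewrite mulr_sumr; apply: eq_big_nat => m mp; rewrite w1 //; ring.
rewrite U_recr // w2a w2b HE; last by exact: leq_trans p0p.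
set s := \sum_(m0 <= m < p) _; set c := _ - H p0 z * phi z t => e.
have {e} -> : s = H p z * phi z t + c * U p0 p - w p p * H p z by rewrite -e addrK.
rewrite phiE /oplus /uw /oplus; have h : z - t != 0 by rewrite subr_eq0.
by field.
Qed.

(** The formal sum of t (+) b and t (-) b does not depend on b. *)
Lemma vw_t k : uw k + vw k + beta * uw k * vw k = t [+] t.
Proof. by rewrite /uw /vw /oplus /ominus; field. Qed.

Lemma rowwt_sum (p q : nat) z : (0 < q < p)%N -> z != t ->
  \sum_(q <= m < p.+1) rowwt p q m true * H m z =
  H p z * phi z t + H q z * phi t z * U q p.
Proof.
move=> /andP[q0 qp] zt.
(* The recursion starts at p = q + 1: for m = q and m = q + 1 the box of offset q, which lies above
   the end of the next row, has special weights. *)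
rewrite (@row_sum_solve (fun p m => rowwt p q m true) q q.+1) //; last 2 first.
- move=> p' m qp' qmp; rewrite /rowwt.
  have -> : (q <= m <= p'.+1)%N by lia.
  have -> : (q <= m <= p')%N by lia.
  have -> : (m == p'.+1) = false by lia.
  have -> : (m == p') = false by lia.
  by rewrite U_recr ?mulrA //; lia.
- move=> p' qp'; rewrite /rowwt.
  have -> : (q <= p' <= p'.+1)%N by lia.
  have -> : (q <= p'.+1 <= p'.+1)%N by lia.
  have -> : (q <= p' <= p')%N by lia.
  have -> : (p' == p'.+1) = false by lia.
  have -> : (p' == q) = false by lia.
  have -> : (q.+1 < p'.+1)%N by lia.
  by rewrite !eqxx !U_geq //; split; ring.
rewrite big_ltn // big_nat1 HE // (@U_recl q p) //.
rewrite /rowwt.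
have -> : (q <= q <= q.+1)%N by lia.
have -> : (q <= q.+1 <= q.+1)%N by lia.
have -> : (q == q.+1) = false by lia.
have -> : (q.+1 < q)%N = false by lia.
rewrite ltnn !eqxx.
rewrite (@U_geq q.+1 q.+1) // (@U_geq q.+2 q.+1) // !phiE /uw /vw /oplus /ominus.
have h : z - t != 0 by rewrite subr_eq0.
have h' : t - z != 0 by rewrite -opprB oppr_eq0.
have -> : true%:R = 1 :> F by [].
by field; rewrite bs0 h h'.
Qed.

(** The term m = 0 is left out: the row then disappears and carries no head. *)
Lemma lastwt_sum om (p : nat) z : (0 < p)%N -> z != t ->
  \sum_(1 <= m < p.+1) lastwt om p m * H m z =
  H p z * phi z t + U 1 p * (H 1 z * (1 + beta * om - phi z t)).
Proof.
move=> p0 zt.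
rewrite (@row_sum_solve (lastwt om) 1 1) //; last 2 first.
- move=> p' m p1 mp; rewrite /lastwt.
  have -> : (m <= p'.+1)%N by lia.
  have -> : (m <= p')%N by lia.
  have -> : (m == 0%N) = false by lia.
  have -> : (m == p'.+1) = false by lia.
  have -> : (m == p') = false by lia.
  by rewrite U_recr ?mulrA //; lia.
- move=> p' p1; rewrite /lastwt.
  have -> : (p' <= p'.+1)%N by lia.
  have -> : (p' == 0%N) = false by lia.
  have -> : (p' == p'.+1) = false by lia.
  have -> : (1 < p'.+1)%N by lia.
  by rewrite !leqnn !eqxx !U_geq //; split=> /=; ring.
rewrite big_nat1 /lastwt /= U_geq //; ring.
Qed.

Lemma head_U p q : (0 < q <= p)%N -> H p t = H q t * U q p.
Proof.
case/andP=> q0; elim: p => [|p IH]; first by lia.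
rewrite leq_eqVlt => /predU1P[->|qp]; first by rewrite U_geq ?mulr1.
by rewrite HE ?(leq_trans q0) // IH // U_recr // /uw; ring.
Qed.

End Head.

(** The constraint removes weights in the ratio 1 : beta at m = q and m = q + 1, the ratio needed
    for the symmetrizations to cancel. *)
Lemma rowwt_false (p q m : nat) : (q < p)%N ->
  rowwt p q m true = rowwt p q m false +
    (if m == q then vw q * U q.+1 p
     else if m == q.+1 then beta * (vw q * U q.+1 p) else 0).
Proof.
move=> qp; rewrite /rowwt.
have -> : true%:R = 1 :> F by [].
have -> : false%:R = 0 :> F by [].
case: (eqVneq m q) => [->|mq].
  have -> : (q <= q <= p)%N by lia.
  have -> : (q == p) = false by lia.
  rewrite /=; ring.
case: (eqVneq m q.+1) => [->|mq']; last by rewrite addr0.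
have -> : (q <= q.+1 <= p)%N by lia.
rewrite ltnn /=.
case: (eqVneq q.+1 p) => [<-|qp'].
  by rewrite !U_geq //; ring.
have -> : U q.+1 p = uw q.+1 * U q.+2 p by rewrite U_recl // ltn_neqAle qp'.
ring.
Qed.

End RowSums.

(** * Branching rule for the symmetrizations *)

Definition parts (R C : nat) (nu : {ffun 'I_R -> 'I_C.+1}) (i : nat) : nat :=
  oapp (fun j => nat_of_ord (nu j)) 0%N (insub i).

Lemma partsE R C (nu : {ffun 'I_R -> 'I_C.+1}) (i : 'I_R) : parts nu i = nu i.
Proof. by rewrite /parts valK. Qed.

Lemma parts_out R C (nu : {ffun 'I_R -> 'I_C.+1}) i : (R <= i)%N -> parts nu i = 0%N.
Proof. by move=> h; rewrite /parts insubN // -leqNgt. Qed.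

Lemma parts_upd R C (nu : {ffun 'I_R -> 'I_C.+1}) (k : 'I_R) m i :
  parts (upd nu k m) i = if i == k then m : nat else parts nu i.
Proof.
case: (ltnP i R) => iR; last first.
  by rewrite !parts_out // (_ : (i == k) = false) //; have := ltn_ord k; lia.
by rewrite !(partsE _ (Ordinal iR)) ffunE -val_eqE /=; case: ifP.
Qed.

Lemma sum_prod_parts (F : fieldType) (R C : nat) (G : nat -> nat -> F) :
  \sum_(nu : {ffun 'I_R -> 'I_C.+1}) \prod_(0 <= i < R) G i (parts nu i) =
  \prod_(0 <= i < R) \sum_(0 <= m < C.+1) G i m.
Proof.
rewrite big_mkord.
under [RHS]eq_bigr do rewrite big_mkord.
rewrite (bigA_distr_bigA (fun (i : 'I_R) (m : 'I_C.+1) => G i m)).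
by apply: eq_bigr => nu _; rewrite big_mkord; apply: eq_bigr => i _; rewrite partsE.
Qed.

Section Branch.
Variables (F : fieldType) (beta : F) (bs : nat -> F).
Hypothesis charF0 : forall n, (n.+1%:R : F) != 0.
Hypothesis bs0 : forall k, 1 + beta * bs k != 0.
Local Notation phi := (phi beta).
Local Notation nondeg := (nondeg beta).
Local Notation Phi := (Phi beta).
Local Notation "x [+] y" := (oplus beta x y) (at level 50).
Variable (H : nat -> F -> F).
Hypothesis HE : forall k z, (0 < k)%N -> H k.+1 z = (z [+] bs k) * H k z.

Definition symP (nu : nat -> nat) (l N : nat) (x : nat -> F) : F :=
  ((N - l)`!%:R)^-1 *
  Sym N (fun y => (\prod_(0 <= i < l) H (nu i) (y i)) * Phi l N y) x.

(** With q = nu_k, the combined summand contains 1 + beta (y_k (+) bs_q) = (1 + beta y_k)(1 + beta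
    bs_q). Its product with phi(y_k, y_(k+1)) has a symmetric numerator over y_k - y_(k+1), hence is
    antisymmetric. *)
Lemma symP_straighten (nu nu' : nat -> nat) (l N k : nat) x : nondeg N x ->
  (k.+1 < l)%N -> (l <= N)%N -> (0 < nu k)%N -> nu k = nu k.+1 ->
  nu' k = (nu k).+1 -> (forall i, i != k -> nu' i = nu i) ->
  symP nu l N x + beta * symP nu' l N x = 0.
Proof.
move=> xn kl lN q0 nuk nu'k nu'E.
rewrite /symP mulrCA -mulrDr -SymZ -SymD; apply/eqP; rewrite mulf_eq0; apply/orP; right; apply/eqP.
pose P y := (\prod_(0 <= i < l) H (nu i) (y i)) * (1 + beta * (y k [+] bs (nu k))).
rewrite -[RHS](@Sym_kill F beta (charF0 1) l N k P x) //.
  apply: eq_Sym => w; set y := act w x.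
  have -> : \prod_(0 <= i < l) H (nu' i) (y i) =
      (y k [+] bs (nu k)) * \prod_(0 <= i < l) H (nu i) (y i).
    rewrite !big_mkord; have kl' : (k < l)%N by lia.
    rewrite !(bigD1 (Ordinal kl') (P := xpredT)) //= nu'k HE // mulrA; congr (_ * _).
    by apply: eq_bigr => i; rewrite -val_eqE /= => /nu'E ->.
  rewrite /P; ring.
move=> w; set y := act w x; rewrite /P /= swapn_l.
have -> : \prod_(0 <= i < l) H (nu i) (y (swapn k k.+1 i)) = \prod_(0 <= i < l) H (nu i) (y i).
  rewrite -(@big_swapn _ _ _ 0 l k k.+1 xpredT (fun i => H (nu i) (y i))); try lia.
  apply: eq_big_nat => i _; congr (H _ _); rewrite /swapn.
  by case: (eqVneq i k) => [->|_] //; case: (eqVneq i k.+1) => [->|].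
have [h _] : nondeg N y by exact: nondeg_act.
have h1 : y k - y k.+1 != 0 by rewrite subr_eq0; apply: h; lia.
have h2 : y k.+1 - y k != 0 by rewrite -opprB oppr_eq0.
by rewrite !phiE /oplus; field; rewrite h1 h2.
Qed.

Variables (R C N a : nat) (x : nat -> F) (mu : nat -> nat) (om : F).
Hypothesis xn : nondeg N.+1 x.
Hypotheses (aN : (a <= N)%N) (aR : (a < R)%N).
Hypothesis muC : forall i, (mu i <= C)%N.
Hypothesis mua : (0 < mu a)%N.
Hypothesis mu_strict : forall i, (i < a)%N -> (mu i.+1 < mu i)%N.
Let t := x N.
Hypothesis om_diag : forall y, nondeg (N - a) y -> away (N - a) y t ->
  diag_id beta (H 1%N) om (N - a) y t.

Definition shiftrow_weight (i m : nat) (d : bool) : F :=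
  if (i < a)%N then rowwt beta bs t (mu i) (mu i.+1) m d
  else if i == a then lastwt beta bs t om (mu a) m
  else (m == 0%N)%:R.
Local Notation rw := shiftrow_weight.

(** The value 0 is that of the tableau sum when the a + 1 parts outnumber the N variables. *)
Definition symP_rows (nu : nat -> nat) : F :=
  if nu a == 0%N then symP nu a N x
  else if (a < N)%N then symP nu a.+1 N x else 0.

Lemma mu_pos i : (i <= a)%N -> (0 < mu i)%N.
Proof.
move=> ia; case: (ltngtP i a) ia => // [ia|->] _ //.
by apply: leq_ltn_trans (mu_strict ia).
Qed.

(** Rows are freed from the top: once row k - 1 is free, nu_k enters only the weight of row k and
    the symmetrization, so the terms nu_k = q and nu_k = q + 1 can be paired. *)
Lemma drop_constraint (k : nat) : (k < a)%N ->
  \sum_(nu : {ffun 'I_R -> 'I_C.+1})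
    (\prod_(0 <= i < R) rw i (parts nu i)
        ((i < k)%N || (parts nu i.+1 < mu i.+1)%N)) * symP_rows (parts nu) =
  \sum_(nu : {ffun 'I_R -> 'I_C.+1})
    (\prod_(0 <= i < R) rw i (parts nu i)
        ((i < k.+1)%N || (parts nu i.+1 < mu i.+1)%N)) * symP_rows (parts nu).
Proof.
move=> ka; have kR : (k < R)%N by lia.
set q := mu k.+1.
have qp : (q < mu k)%N by exact: mu_strict.
have q0 : (0 < q)%N by exact: mu_pos.
pose E m : F := if m == q then vw beta bs t q * U beta bs t q.+1 (mu k)
  else if m == q.+1 then beta * (vw beta bs t q * U beta bs t q.+1 (mu k)) else 0.
pose g (nu : nat -> nat) := \prod_(0 <= i < R | i != k) rw i (nu i) ((i < k)%N || (nu i.+1 < mu i.+1)%N).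
(* [f] is the summand with row k free minus the summand with row k constrained. *)
pose f (nu : {ffun 'I_R -> 'I_C.+1}) :=
  g (parts nu) * ((~~ (parts nu k.+1 < q)%N)%:R * E (parts nu k)) * symP_rows (parts nu).
have f0 : \sum_nu f nu = 0.
  have qC : (q.+1 < C.+1)%N by rewrite ltnS (leq_trans qp).
  have qC' : (q < C.+1)%N by lia.
  apply: (@sum_pair_cancel _ _ _ (Ordinal kR) (Ordinal qC') (Ordinal qC)).
  - by rewrite -val_eqE /= ltn_eqF.
  - move=> nu; rewrite -!val_eqE /= -!(partsE nu (Ordinal kR)) /= => /negPf e1 /negPf e2.
    by rewrite /f /E e1 e2 !mulr0 mul0r.
  - move=> nu /(congr1 val) /=; rewrite -(partsE nu (Ordinal kR)) /= => nuk.
    set nu' := upd nu _ _.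
    have nu'E i : parts nu' i = if i == k then q.+1 else parts nu i by rewrite parts_upd.
    have nu'k : parts nu' k = q.+1 by rewrite nu'E eqxx.
    have nu'N i : i != k -> parts nu' i = parts nu i by rewrite nu'E => /negPf ->.
    have gE : g (parts nu') = g (parts nu).
      rewrite /g big_nat_cond [RHS]big_nat_cond; apply: eq_bigr => i /andP[_ ik].
      rewrite nu'N //; case: (ltnP i k) => //= ki.
      by rewrite nu'N //; lia.
    rewrite /f gE nu'k nuk nu'N; last by lia.
    rewrite /E !eqxx (_ : (q.+1 == q) = false); last by lia.
    (* Below q the constraint holds and [f] is 0; above q the weight of row k + 1 vanishes; only
       equality needs the straightening. *)
    case: (ltngtP (parts nu k.+1) q) => [|qk|ek] /=; first by rewrite !mul0r !mulr0 !mul0r addr0.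
      have -> : g (parts nu) = 0.
        have k1R : (k.+1 < R)%N by lia.
        rewrite /g big_mkord (bigD1 (Ordinal k1R)) /=; last by lia.
        rewrite /rw; case: ifP => k1a.
          by rewrite /rowwt (_ : (_ <= _ <= _)%N = false) ?mul0r //; lia.
        rewrite (_ : (k.+1 == a) = true); last by lia.
        rewrite /lastwt (_ : (_ <= _)%N = false) ?mul0r //.
        by rewrite -(_ : k.+1 = a) //; lia.
      by rewrite !mul0r addr0.
    have S0 : symP_rows (parts nu) + beta * symP_rows (parts nu') = 0.
      have xn' : nondeg N x by exact: nondeg_leq xn.
      rewrite /symP_rows (nu'N a); last by lia.
      case: eqP => nua.
        apply: (@symP_straighten _ _ _ _ k); rewrite ?nuk ?ek ?nu'k //.
        (* k + 1 = a is impossible, as nu_a = 0 while nu_(k+1) = q > 0. *)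
        rewrite ltn_neqAle ka andbT; apply/eqP => k1a.
        by move: nua; rewrite -k1a ek => q0'; rewrite q0' in q0.
      case: ltnP => aN'; last by rewrite mulr0 addr0.
      by apply: (@symP_straighten _ _ _ _ k); rewrite ?nuk ?ek ?nu'k.
    set c := vw _ _ _ _ * _.
    rewrite -[RHS](mulr0 (g (parts nu) * c)) -S0; ring.
apply/eqP; rewrite eq_sym -subr_eq0 -sumrB; apply/eqP; rewrite -[RHS]f0.
apply: eq_bigr => nu _; rewrite -mulrBl /f; congr (_ * _).
rewrite !big_mkord !(bigD1 (Ordinal kR) (P := xpredT)) //= ltnSn ltnn /=.
rewrite (_ : g (parts nu) = \prod_(i < R | i != Ordinal kR)
   rw i (parts nu i) ((i < k)%N || (parts nu i.+1 < mu i.+1)%N)); last first.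
  by rewrite /g big_mkord; apply: eq_bigl => i; rewrite -val_eqE.
have -> : \prod_(i < R | i != Ordinal kR)
   rw i (parts nu i) ((i < k.+1)%N || (parts nu i.+1 < mu i.+1)%N) =
   \prod_(i < R | i != Ordinal kR)
   rw i (parts nu i) ((i < k)%N || (parts nu i.+1 < mu i.+1)%N).
  apply: eq_bigr => i; rewrite -val_eqE /= => ik.
  by rewrite ltnS leq_eqVlt (negPf ik).
rewrite -mulrBl mulrC; congr (_ * _).
rewrite /rw ka rowwt_false // -/q -/(E (parts nu k)).
by case: (parts nu k.+1 < q)%N; rewrite ?rowwt_false // -/(E (parts nu k)) /= ?mul0r ?mul1r ?subrr // addrAC subrr add0r.
Qed.

Lemma drop_constraints :
  \sum_(nu : {ffun 'I_R -> 'I_C.+1})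
    (\prod_(0 <= i < R) rw i (parts nu i) (parts nu i.+1 < mu i.+1)%N) *
      symP_rows (parts nu) =
  \sum_(nu : {ffun 'I_R -> 'I_C.+1})
    (\prod_(0 <= i < R) rw i (parts nu i) true) * symP_rows (parts nu).
Proof.
transitivity (\sum_(nu : {ffun 'I_R -> 'I_C.+1})
    (\prod_(0 <= i < R) rw i (parts nu i)
        ((i < a)%N || (parts nu i.+1 < mu i.+1)%N)) * symP_rows (parts nu)).
  have h k : (k <= a)%N ->
   \sum_(nu : {ffun 'I_R -> 'I_C.+1})
    (\prod_(0 <= i < R) rw i (parts nu i) (parts nu i.+1 < mu i.+1)%N) *
      symP_rows (parts nu) =
   \sum_(nu : {ffun 'I_R -> 'I_C.+1})
    (\prod_(0 <= i < R) rw i (parts nu i)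
        ((i < k)%N || (parts nu i.+1 < mu i.+1)%N)) * symP_rows (parts nu).
    elim: k => [|k IH] ka; first by [].
    by rewrite IH; [exact: drop_constraint | exact: ltnW].
  exact: h.
apply: eq_bigr => nu _; congr (_ * _); apply: eq_bigr => i _.
by rewrite /rw; case: (i < a)%N.
Qed.

(** Free of constraints, the sum over nu factors into row sums. The open factor [g] of the last row
    serves for both cases, the row vanishing or keeping a head. *)
Lemma sum_rows (g : nat -> F) y : away N y t ->
  \sum_(nu : {ffun 'I_R -> 'I_C.+1})
    (\prod_(0 <= i < R) rw i (parts nu i) true) * g (parts nu a) *
     \prod_(0 <= i < a) H (parts nu i) (y i) =
  (\prod_(0 <= i < a) (H (mu i) (y i) * phi (y i) t +
     H (mu i.+1) (y i) * phi t (y i) * U beta bs t (mu i.+1) (mu i))) *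
  \sum_(0 <= m < (mu a).+1) lastwt beta bs t om (mu a) m * g m.
Proof.
move=> ya.
pose G i m : F := rw i m true * (if (i < a)%N then H m (y i) else if i == a then g m else 1).
transitivity (\sum_(nu : {ffun 'I_R -> 'I_C.+1}) \prod_(0 <= i < R) G i (parts nu i)).
  apply: eq_bigr => nu _; rewrite /G big_split /= -mulrA; congr (_ * _).
  rewrite (@big_cat_nat _ _ _ a 0 R) //=; last by lia.
  rewrite (@big_ltn _ _ _ a R) // ltnn eqxx mulrC; congr (_ * _).
    by apply: eq_big_nat => i /andP[_ ->].
  rewrite big_nat_cond big1 ?mulr1 // => i /andP[/andP[ai _] _].
  have -> : (i < a)%N = false by apply/negbTE; rewrite -leqNgt ltnW.
  by rewrite gtn_eqF.
rewrite sum_prod_parts (@big_cat_nat _ _ _ a 0 R) //=; last by lia.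
rewrite (@big_ltn _ _ _ a R) //; congr (_ * _).
  apply: eq_big_nat => i /andP[_ ia]; rewrite /G ia.
  have pC := muC i; have qp := mu_strict ia.
  rewrite -(rowwt_sum bs0 HE); last 2 first.
  - by rewrite qp andbT mu_pos.
  - by rewrite eq_sym; apply: ya; lia.
  rewrite (@big_cat_nat _ _ _ (mu i.+1) 0 C.+1) //=; last by lia.
  rewrite (@big_cat_nat _ _ _ (mu i).+1 (mu i.+1) C.+1) //=; last by lia.
  rewrite [X in X + _]big_nat_cond [X in X + _]big1 ?add0r; last first.
    by move=> m mq; rewrite /rw ia /rowwt (_ : (_ <= _ <= _)%N = false) ?mul0r //; lia.
  rewrite [X in _ + X]big_nat_cond [X in _ + X]big1 ?addr0; last first.
    by move=> m mq; rewrite /rw ia /rowwt (_ : (_ <= _ <= _)%N = false) ?mul0r //; lia.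
  by apply: eq_bigr => m _; rewrite /rw ia.
rewrite [X in _ * X]big_nat_cond [X in _ * X]big1 ?mulr1; last first.
  move=> i /andP[/andP[ai _] _].
  have ia : (i < a)%N = false by apply/negbTE; rewrite -leqNgt ltnW.
  have ia' : (i == a) = false by rewrite gtn_eqF.
  rewrite big_ltn // big_nat_cond big1 ?addr0.
    by rewrite /G /rw ia ia' mulr1.
  move=> m /andP[/andP[m0 _] _]; rewrite /G /rw ia ia' mulr1.
  by rewrite gtn_eqF.
have pC := muC a.
rewrite (@big_cat_nat _ _ _ (mu a).+1 0 C.+1) //=.
rewrite [X in _ + X]big_nat_cond [X in _ + X]big1 ?addr0; last first.
  move=> m mq; rewrite /G /rw ltnn eqxx /lastwt (_ : (_ <= _)%N = false) ?mul0r //; lia.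
by apply: eq_bigr => m _; rewrite /G /rw ltnn eqxx.
Qed.

Theorem symP_branching :
  \sum_(nu : {ffun 'I_R -> 'I_C.+1})
    (\prod_(0 <= i < R) rw i (parts nu i) (parts nu i.+1 < mu i.+1)%N) *
      symP_rows (parts nu) = symP mu a.+1 N.+1 x.
Proof.
rewrite drop_constraints.
have lam0 : \sum_(0 <= m < (mu a).+1) lastwt beta bs t om (mu a) m * (m == 0%N)%:R =
    U beta bs t 1 (mu a) * om.
  rewrite big_ltn // big_nat_cond big1 ?addr0; first by rewrite /lastwt mulr1 mulrC.
  by move=> m /andP[/andP[m0 _] _]; rewrite gtn_eqF // mulr0.
have lamN z : z != t ->
    \sum_(0 <= m < (mu a).+1) lastwt beta bs t om (mu a) m * ((m != 0%N)%:R * H m z) =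
    H (mu a) z * phi z t + U beta bs t 1 (mu a) * (H 1 z * (1 + beta * om - phi z t)).
  move=> zt; rewrite big_ltn // mul0r mulr0 add0r -(lastwt_sum HE) //.
  by apply: eq_big_nat => m /andP[m0 _]; rewrite -lt0n m0 mul1r.
pose Wt (nu : {ffun 'I_R -> 'I_C.+1}) := \prod_(0 <= i < R) rw i (parts nu i) true.
pose Rs (y : nat -> F) := \prod_(0 <= i < a) (H (mu i) (y i) * phi (y i) t +
     H (mu i.+1) (y i) * phi t (y i) * U beta bs t (mu i.+1) (mu i)).
pose Cl z := U beta bs t 1 (mu a) * (H 1 z * (1 + beta * om - phi z t)).
have xN : away N x t by exact: nondeg_away xn.
have S0 : \sum_nu Wt nu * (parts nu a == 0%N)%:R * symP (parts nu) a N x =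
    ((N - a)`!%:R)^-1 * (U beta bs t 1 (mu a) * om * Sym N (fun y => Rs y * Phi a N y) x).
  rewrite -SymZ /symP.
  under eq_bigr do rewrite mulrCA.
  rewrite -mulr_sumr; congr (_ * _).
  under eq_bigr do rewrite -SymZ.
  rewrite /Sym exchange_big; apply: eq_bigr => w _ /=.
  have ya := away_act w xN; have e := sum_rows (fun m => (m == 0%N)%:R) ya.
  under eq_bigr do rewrite mulrA.
  rewrite -mulr_suml e lam0 -/(Rs _); ring.
have S1 : (a < N)%N ->
    \sum_nu Wt nu * (parts nu a != 0%N)%:R * symP (parts nu) a.+1 N x =
    ((N - a.+1)`!%:R)^-1 *
    Sym N (fun y => Rs y * (H (mu a) (y a) * phi (y a) t + Cl (y a)) * Phi a.+1 N y) x.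
  move=> aN'; rewrite /symP.
  under eq_bigr do rewrite mulrCA.
  rewrite -mulr_sumr; congr (_ * _).
  under eq_bigr do rewrite -SymZ.
  rewrite /Sym exchange_big; apply: eq_bigr => w _ /=; set y := act w x.
  have ya : away N y t := away_act w xN.
  have e := sum_rows (fun m => (m != 0%N)%:R * H m (y a)) ya.
  under eq_bigr do rewrite mulrA.
  rewrite -mulr_suml; congr (_ * _).
  rewrite lamN in e; last by rewrite eq_sym; apply: ya.
  by rewrite -e; apply: eq_bigr => nu _; rewrite big_nat_recr //= /Wt; ring.
transitivity (\sum_nu Wt nu * (parts nu a == 0%N)%:R * symP (parts nu) a N x +
    if (a < N)%N then
      \sum_nu Wt nu * (parts nu a != 0%N)%:R * symP (parts nu) a.+1 N x else 0).
  case: ifP => aN'.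
    rewrite -big_split; apply: eq_bigr => nu _; rewrite /symP_rows aN' -/(Wt nu).
    by case: eqP => _; rewrite /= ?mulr1 ?mulr0 ?mul0r ?add0r ?addr0.
  rewrite addr0; apply: eq_bigr => nu _; rewrite /symP_rows aN' -/(Wt nu).
  by case: eqP => _; rewrite /= ?mulr1 ?mulr0 ?mul0r.
rewrite S0 [RHS]/symP subSS.
rewrite -(@Sym_branching F beta (charF0 1) N a x H mu
    (fun i => U beta bs t (mu i.+1) (mu i)) xn aN Cl (U beta bs t 1 (mu a) * om)); last 2 first.
- move=> w; set y := act w x; have yn : nondeg N y by apply: nondeg_act; exact: nondeg_leq xn.
  have ya : away N y t := away_act w xN.
  pose y' i := y (i + a)%N.
  have yn' : nondeg (N - a) y'.
    case: yn => h1 h2; split=> [i j iN jN ij|i iN]; first by apply: h1; lia.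
    by apply: h2; lia.
  have ya' : away (N - a) y' t by move=> i iN; apply: ya; lia.
  (* Multiplying the diagonal identity by U(1, mu_a) turns H_1(t) into H_(mu_a)(t). *)
  have := om_diag yn' ya'; rewrite /diag_id => /(congr1 ( *%R (U beta bs t 1 (mu a)))).
  rewrite mulrDr mulr_sumr mulrA [U _ _ _ _ _ * H 1 t]mulrC -(head_U t HE); last first.
    by rewrite mua.
  move=> e; rewrite -/t.
  have -> : \prod_(a <= i < N) phi t (y i) = \prod_(i < N - a) phi t (y' i).
    by rewrite -{1}[a]add0n big_addn big_mkord.
  rewrite -e; congr (_ + _).
  rewrite -{1}[a]add0n big_addn big_mkord; apply: eq_bigr => i _.
  rewrite /Cl /phiprod -!mulrA; congr (_ * (_ * (_ * _))).
  rewrite -{1}[a]add0n big_addn big_mkord; apply: eq_bigl => k.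
  by rewrite eqn_add2r.
- move=> j ja; rewrite -/t.
  elim: {j ja}(a - j)%N {-2}j (erefl (a - j)%N) ja => [|d IH] j ej ja.
    have -> : j = a by lia.
    by rewrite big_geq // mulr1.
  rewrite big_ltn; last by lia.
  rewrite mulrCA IH; try lia.
  rewrite [RHS](head_U t HE (q := mu j.+1)) 1?mulrC //.
  by rewrite mu_pos ?(ltnW (mu_strict _)); lia.
rewrite mulrDr addrC; congr (_ + _).
case: ifP => aN'; last by rewrite (_ : (N - a = 0)%N) ?mul0r ?mulr0 //; lia.
rewrite S1 // mulrA; congr (_ * _).
(* The normalizations for a and for a + 1 rows differ by the factor N - a of [Sym_branching]. *)
have -> : (N - a = (N - a.+1).+1)%N by lia.
rewrite factS natrM invfM mulrAC mulVf ?mul1r //.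
Qed.

End Branch.

(** * Letters added by the last variable *)

(* The letters N' and N allowed in the box with offset [k] of a row of length
   [p], when the smaller letters fill [m] boxes of this row and [q'] boxes of the
   next row, whose length is [q]. [e] tells whether N' or N occurs in the last
   box filled by the smaller letters. *)
Definition box_ok (p q m q' k : nat) (e dp du : bool) (pu : bool * bool) : bool :=
  [&& ((pu.1 || pu.2) || (k < m)%N) == (k < p)%N,
      (pu.1 || pu.2) ==> (m <= k.+1)%N,
      (pu.1 || pu.2) ==> ~~ ((0 < k)%N && (k <= q')%N),
      pu.2 ==> ~~ ((0 < k)%N && (k <= q)%N),
      (k == 0%N) ==> ((pu.1 ==> dp) && (pu.2 ==> du)),
      pu.1 ==> (k <= m)%N,
      (k.+1 == m) ==> ((pu.1 || pu.2) == e)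
    & ((k == m) && e) ==> ~~ pu.1].

Lemma big_bool2 (V : nmodType) (P : pred (bool * bool)) (f : bool * bool -> V) :
  \sum_(pu | P pu) f pu =
  (if P (true, true) then f (true, true) else 0) +
  (if P (true, false) then f (true, false) else 0) +
  ((if P (false, true) then f (false, true) else 0) +
  (if P (false, false) then f (false, false) else 0)).
Proof.
rewrite big_mkcond; pose g a b := if P (a, b) then f (a, b) else 0.
transitivity (\sum_(pu : bool * bool) g pu.1 pu.2); first by apply: eq_bigr => -[].
by rewrite -(pair_bigA _ g) /= !big_bool.
Qed.

Section RowEvaluation.
Variables (F : fieldType) (beta : F) (bs : nat -> F) (t : F).
Hypothesis bs0 : forall k, 1 + beta * bs k != 0.
Local Notation uw := (uw beta bs t).
Local Notation vw := (vw beta bs t).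
Local Notation "x [+] y" := (oplus beta x y) (at level 50).

(** One new letter costs no beta in a box without smaller letters; by truncated subtraction a box
    left empty weighs 1. *)
Definition new_weight (inn : bool) (k : nat) (pu : bool * bool) : F :=
  beta ^+ ((pu.1 + pu.2) - ~~ inn)%N *
  ((if pu.1 then vw k else 1) * (if pu.2 then uw k else 1)).

Definition box_sum (p q m q' k : nat) (e dp du : bool) : F :=
  \sum_(pu | box_ok p q m q' k e dp du pu) new_weight (k < m)%N k pu.

(** Within a row only boxes m - 1 and m interact: a new letter in the former excludes N' from the
    latter. For fixed [e] the choices are independent. *)
Definition row_sum (l p q m q' : nat) (dp du : bool) : F :=
  \sum_(e : bool) ((m == 0%N) ==> ~~ e)%:R *
    \prod_(0 <= k < l) box_sum p q m q' k e dp du.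

Variables (p q m q' : nat) (dp du : bool).
Hypotheses (mp : (m <= p)%N) (qq : (q' <= q)%N).

Lemma box_sum_before k e : (k.+1 < m)%N -> box_sum p q m q' k e dp du = 1.
Proof.
move=> km; rewrite /box_sum big_bool2 /box_ok /new_weight /=.
have -> : (m <= k.+1)%N = false by lia.
have -> : (k < p)%N by lia.
have -> : (k < m)%N by lia.
have -> : (k.+1 == m) = false by lia.
have -> : (k == m) = false by lia.
by rewrite /= !implybT /= expr0 !mulr1 !add0r.
Qed.

Lemma box_sum_after k e : (p <= k)%N -> box_sum p q m q' k e dp du = 1.
Proof.
move=> km; rewrite /box_sum big_bool2 /box_ok /new_weight /=.
have -> : (k < p)%N = false by lia.
have -> : (k < m)%N = false by lia.
have -> : (k.+1 == m) = false by lia.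
by rewrite /= !implybT /= expr0 !mulr1 !add0r.
Qed.

Lemma box_sum_middle k e : (m < k < p)%N ->
  box_sum p q m q' k e dp du = if (q < k)%N then uw k else 0.
Proof.
move=> km; rewrite /box_sum big_bool2 /box_ok /new_weight /=.
have -> : (k < p)%N by lia.
have -> : (k < m)%N = false by lia.
have -> : (k.+1 == m) = false by lia.
have -> : (k == m) = false by lia.
have -> : (k == 0%N) = false by lia.
have -> : (0 < k)%N by lia.
have -> : (m <= k.+1)%N by lia.
have -> : (k <= m)%N = false by lia.
rewrite /= !andbF /= !add0r !addr0 subnn expr0 !mul1r.
have -> : (q < k)%N = ~~ (k <= q)%N by lia.
case: (leqP k q) => kq; rewrite ?andbF //=.
by have -> : (k <= q')%N = false by lia.
Qed.

Lemma box_sum_first e : (m < p)%N -> box_sum p q m q' m e dp du =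
  if (0 < m)%N && (m <= q')%N then 0 else
  (if e || (m == 0%N) && ~~ dp then 0 else vw m) +
  (if (0 < m)%N && (m <= q)%N || (m == 0%N) && ~~ du then 0 else uw m) +
  (if e || (m == 0%N) && ~~ (dp && du) || (0 < m)%N && (m <= q)%N
   then 0 else beta * uw m * vw m).
Proof.
move=> lt; rewrite /box_sum big_bool2 /box_ok /new_weight /=.
have -> : (m.+1 == m) = false by lia.
have -> : (m == 0%N) = ~~ (0 < m)%N by lia.
rewrite lt ltnn (eqxx m) leqnn leqnSn /=.
by case: e; case: dp; case: du; case: ((0 < m)%N);
  case: (m <= q')%N; case: (m <= q)%N; rewrite /= ?expr0 ?expr1; ring.
Qed.

Lemma box_sum_last e : (0 < m)%N -> box_sum p q m q' m.-1 e dp du =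
  if e then
   (if (1 < m)%N && (m.-1 <= q')%N then 0 else
    beta * ((if (m == 1%N) && ~~ dp then 0 else vw m.-1) +
    (if (1 < m)%N && (m.-1 <= q)%N || (m == 1%N) && ~~ du then 0 else uw m.-1) +
    (if (m == 1%N) && ~~ (dp && du) || (1 < m)%N && (m.-1 <= q)%N
     then 0 else beta * uw m.-1 * vw m.-1)))
  else 1.
Proof.
case: m mp => // m' mp' _; rewrite /box_sum big_bool2 /box_ok /new_weight /=.
have -> : (m' == m'.+1) = false by lia.
have -> : (m'.+1 == 1%N) = ~~ (0 < m')%N by lia.
have -> : (m' == 0%N) = ~~ (0 < m')%N by lia.
have -> : (1 < m'.+1)%N = (0 < m')%N by lia.
rewrite mp' leqnSn ltnSn (eqxx m'.+1) /=.
by case: e; case: dp; case: du; case: ((0 < m')%N);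
  case: (m' <= q')%N; case: (m' <= q)%N; rewrite /= ?expr0 ?expr1 ?expr2; ring.
Qed.

Lemma row_sumE (l : nat) : (p <= l)%N ->
  row_sum l p q m q' dp du =
  let last e := if (0 < m)%N then box_sum p q m q' m.-1 e dp du else 1 in
  let first e := if (m < p)%N then box_sum p q m q' m e dp du *
       \prod_(m.+1 <= k < p) (if (q < k)%N then uw k else 0) else 1 in
  first false + (if (0 < m)%N then last true * first true else 0).
Proof.
move=> pl /=.
have h e : \prod_(0 <= k < l) box_sum p q m q' k e dp du =
   (if (0 < m)%N then box_sum p q m q' m.-1 e dp du else 1) *
   (if (m < p)%N then box_sum p q m q' m e dp du *
       \prod_(m.+1 <= k < p) (if (q < k)%N then uw k else 0) else 1).
  rewrite (@big_cat_nat _ _ _ m 0 l) //=; last by lia.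
  congr (_ * _).
    case: (ltnP 0 m) => m0; last by rewrite big_geq.
    rewrite -{1}(prednK m0) big_nat_recr //= big_nat_cond big1 ?mul1r //.
    by move=> k km; apply: box_sum_before; lia.
  rewrite (@big_cat_nat _ _ _ p m l) //=.
  rewrite [X in _ * X]big_nat_cond [X in _ * X]big1 ?mulr1; last first.
    by move=> k km; apply: box_sum_after; lia.
  case: (ltnP m p) => lt; last by rewrite big_geq.
  rewrite big_ltn //; congr (_ * _); apply: eq_big_nat => k km.
  exact: box_sum_middle.
rewrite /row_sum big_bool /= !h.
case: (posnP m) => [m0|m0]; first by rewrite m0 /= mul0r add0r mul1r addr0 mul1r.
rewrite /= !mul1r addrC; congr (_ + _).
by rewrite box_sum_last // mul1r.
Qed.

Lemma prod_middle : (q <= m)%N ->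
  \prod_(m.+1 <= k < p) (if (q < k)%N then uw k else 0) = U beta bs t m.+1 p.
Proof.
move=> qm; apply: eq_big_nat => k mk.
by have -> : (q < k)%N by lia.
Qed.

Lemma row_sum_inner (l : nat) : (p <= l)%N -> (0 < q < p)%N ->
  row_sum l p q m q' dp du = rowwt beta bs t p q m (q' < q)%N.
Proof.
move=> pl qp; rewrite row_sumE // /rowwt /=.
(* For m < q, box m + 1 would have to hold N above a box of the next row; this gives the interlacing
   mu_(i+1) <= nu_i. *)
case: (ltnP m q) => [mq|qm] /=.
  have -> : (m < p)%N by lia.
  have mp' : (m.+1 < p)%N by lia.
  rewrite (big_ltn mp') (_ : (q < m.+1)%N = false); last by lia.
  by rewrite !mul0r !mulr0 if_same addr0.
have m0 : (0 < m)%N by lia.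
have m0' : (m == 0%N) = false by lia.
have U1 : m == p -> U beta bs t m.+1 p = 1 by move=> /eqP ->; rewrite U_geq.
have fE e : (m < p)%N -> box_sum p q m q' m e dp du =
  if m == q then if e then 0 else ((q' < q)%N)%:R * vw q
  else if e then uw m else t [+] t.
  move=> mp'; rewrite box_sum_first // m0 m0' /= ?andbT ?orbF.
  case: (eqVneq m q) => [->|mq].
    rewrite leqnn orbT ltnNge; case: (q <= q')%N; case: e; rewrite /= ?mul0r ?mul1r ?addr0 //.
  have -> : (m <= q')%N = false by lia.
  have -> : (m <= q)%N = false by lia.
  rewrite orbF; case: e; rewrite ?add0r ?addr0 // -(vw_t t bs0 m); ring.
have lE : box_sum p q m q' m.-1 true dp du =
    if (q.+1 < m)%N then beta * (t [+] t)
    else if m == q.+1 then (q' < q)%N%:R * (beta * vw q)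
    else box_sum p q m q' m.-1 true dp du.
  case: ifP => [qm'|_].
    rewrite box_sum_last //.
    have -> : (m == 1%N) = false by lia.
    have -> : (m.-1 <= q')%N = false by lia.
    have -> : (m.-1 <= q)%N = false by lia.
    by rewrite /= !andbF /= -(vw_t t bs0 m.-1); congr (_ * _); ring.
  case: eqP => // mq; rewrite box_sum_last // mq /=.
  have -> : (1 < q.+1)%N by lia.
  have -> : (q.+1 == 1%N) = false by lia.
  rewrite leqnn /= ltnNge; case: (q <= q')%N; rewrite /= ?mul0r ?mul1r ?addr0 //.
rewrite mp m0 /= prod_middle //.
case: (ltngtP m p) mp => // [mp' _|mp' _].
  rewrite !fE // lE; case: (eqVneq m q) => [->|mq].
    by rewrite mul0r mulr0 addr0.
  rewrite mulrA -mulrDl; congr (_ * _).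
  by case: ifP => // h; case: ifP => // h'; lia.
rewrite lE mulr1 U1 ?mp' // mulr1.
by case: ifP => // h; case: ifP => // h'; lia.
Qed.

Lemma row_sum_last_row (l : nat) : (p <= l)%N -> q = 0%N -> (0 < p)%N ->
  row_sum l p q m q' dp du =
  lastwt beta bs t (dp%:R * vw 0 + du%:R * uw 0
     + (dp && du)%:R * (beta * uw 0 * vw 0)) p m.
Proof.
move=> pl q0 p0; rewrite row_sumE // /lastwt /= mp.
have q'0 : q' = 0%N by lia.
set om := dp%:R * vw 0 + _ + _.
have fE e : (m < p)%N -> (0 < m)%N -> box_sum p q m q' m e dp du =
  if e then uw m else t [+] t.
  move=> mp' m0; rewrite box_sum_first // m0 q0 q'0.
  have -> : (m == 0%N) = false by lia.
  have -> : (m <= 0)%N = false by lia.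
  by rewrite /= ?orbF; case: e; rewrite /= ?add0r ?addr0 // -(vw_t t bs0 m); ring.
have lE : (0 < m)%N -> box_sum p q m q' m.-1 true dp du =
  if (1 < m)%N then beta * (t [+] t) else beta * om.
  move=> m0; rewrite box_sum_last // q0 q'0; case: (ltnP 1 m) => m1 /=.
    have -> : (m == 1%N) = false by lia.
    have -> : (m.-1 <= 0)%N = false by lia.
    by rewrite -(vw_t t bs0 m.-1) /=; ring.
  have -> : m = 1%N by lia.
  rewrite /= /om; congr (_ * _).
  by case: dp; case: du; rewrite /= ?mul1r ?mul0r ?addr0 ?add0r //; ring.
have f0 : m = 0%N -> box_sum p q m q' m false dp du = om.
  move=> m0; rewrite box_sum_first; last by rewrite m0.
  have -> : (0 < m)%N = false by rewrite m0.
  have -> : (m == 0%N) by rewrite m0.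
  rewrite m0 /= /om.
  by case: dp; case: du; rewrite /= ?mul1r ?mul0r ?addr0 ?add0r //; ring.
rewrite prod_middle; last by rewrite q0.
case: (posnP m) => [m0|m0].
  by rewrite f0 // m0 p0 addr0.
rewrite lE //.
case: (ltngtP m p) mp => // [mp' _|mp' _]; last by rewrite mp' U_geq ?mulr1.
by rewrite !fE // mulrA -mulrDl.
Qed.

Lemma row_sum_empty (l : nat) : p = 0%N -> row_sum l p q m q' dp du = 1.
Proof.
move=> p0; rewrite row_sumE ?p0 //=.
have -> : m = 0%N by lia.
by rewrite addr0.
Qed.

End RowEvaluation.

(** * Branching rule for the tableaux *)

Section Splitting.
Variables (la : seq nat) (n : nat) (dg : nat -> letter n -> bool).
Implicit Types (c d : box la) (a : letter n) (T : filling la n) (mu nu : nat -> nat).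

Lemma letter_leE a a' : letter_le a a' =
  (a.1 < a'.1)%N || ((a.1 == a'.1) && (a.2 ==> a'.2)).
Proof.
rewrite /letter_le -(inj_eq val_inj).
by case: a a' => [i [|]] [j [|]] /=; rewrite ?andbT ?andbF ?orbF; lia.
Qed.

Lemma box_ext c d : brow c = brow d -> offset c = offset d -> c = d.
Proof.
case: c d => [i k] [j l]; rewrite /brow /offset /= => /val_inj ij.
by subst j => /val_inj ->.
Qed.

Lemma offset_lt c : (offset c < nth 0%N la (brow c))%N.
Proof. exact: ltn_ord. Qed.

Lemma box_at i k : (k < nth 0%N la i)%N -> exists c : box la, brow c = i /\ offset c = k.
Proof.
move=> kl; have il : (i < size la)%N.
  by rewrite ltnNge; apply/negP => h; rewrite nth_default in kl.
by exists (@Tagged _ (Ordinal il) (fun j : 'I_(size la) => 'I_(nth 0%N la j)) (Ordinal kl)).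
Qed.

(** In these coordinates the box below offset k has offset k - 1 in the next row. No shape is
    imposed, so the rules pass to subfillings. *)
Record rules T : Prop := {
  rule_row : forall c d a a', brow d = brow c -> offset d = (offset c).+1 ->
    a \in T c -> a' \in T d -> letter_le a a';
  rule_col : forall c d a a', brow d = (brow c).+1 -> offset c = (offset d).+1 ->
    a \in T c -> a' \in T d -> letter_le a a';
  rule_unprimed : forall a c d, a.2 -> a \in T c -> a \in T d ->
    bcol c = bcol d -> c = d;
  rule_primed : forall a c d, ~~ a.2 -> a \in T c -> a \in T d ->
    brow c = brow d -> c = d;
  rule_diag : forall c a, offset c = 0%N -> a \in T c -> dg (brow c) a }.

(* Tableaux of shape [nu] in the letters of index less than [N], seen as fillings
   of the fixed shape [la] by sets that are empty outside [nu]. *)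
Definition istab nu (N : nat) T : Prop :=
  [/\ rules T, (forall c, (T c != set0) = (offset c < nu (brow c))%N)
    & (forall c a, a \in T c -> (a.1 < N)%N)].

Definition shape T (i : nat) : nat :=
  \max_(c : box la | (brow c == i) && (T c != set0)) (offset c).+1.

Lemma shape_le T i : (shape T i <= nth 0%N la i)%N.
Proof.
by apply/bigmax_leqP => c /andP[/eqP <- _]; exact: offset_lt.
Qed.

Lemma shape_spec T : (forall c d, brow d = brow c -> offset d = (offset c).+1 ->
    T d != set0 -> T c != set0) ->
  forall c, (T c != set0) = (offset c < shape T (brow c))%N.
Proof.
move=> dc c; apply/idP/idP => [Tc|].
  by apply: (@leq_bigmax_cond _ _ (fun c => (offset c).+1) c); rewrite eqxx.
move=> h; have [d /andP[/eqP bd Td] cd] : exists2 d : box la,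
    (brow d == brow c) && (T d != set0) & (offset c <= offset d)%N.
  apply: contrapT => nex; move: h; rewrite ltnNge => /negP; apply.
  apply/bigmax_leqP => d Pd; rewrite ltnNge; apply/negP => le.
  by apply: nex; exists d.
have {cd} : exists j, (offset c + j = offset d)%N by exists (offset d - offset c)%N; lia.
case=> j; elim: j d bd Td => [|j IH] d bd Td ed.
  by rewrite (@box_ext c d) //; lia.
have [e [be oe]] : exists e : box la, brow e = brow c /\ offset e = (offset c + j)%N.
  by apply: box_at; have := offset_lt d; rewrite bd; lia.
apply: (IH e) => //; apply: (dc e d) => //; first by rewrite be.
by rewrite oe -ed; lia.
Qed.

Lemma shape_uniq T nu : (forall c, (T c != set0) = (offset c < nu (brow c))%N) ->
  (forall i, (nu i <= nth 0%N la i)%N) -> forall i, shape T i = nu i.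
Proof.
move=> Tnu nula i; apply/eqP; rewrite eqn_leq; apply/andP; split.
  by apply/bigmax_leqP => c /andP[/eqP <-]; rewrite Tnu.
case: (posnP (nu i)) => [->|nu0] //.
have [c [bc oc]] : exists c : box la, brow c = i /\ offset c = (nu i).-1.
  by apply: box_at; have := nula i; lia.
have -> : nu i = (offset c).+1 by lia.
by apply: (@leq_bigmax_cond _ _ (fun c => (offset c).+1) c); rewrite Tnu bc eqxx /= oc; lia.
Qed.

Let R := size la.
Let C := sumn la.

Lemma nth_sumn i : (nth 0%N la i <= C)%N.
Proof.
rewrite /C; elim: la i => [|l s IH] [|i] //=; first exact: leq_addr.
exact: leq_trans (IH i) (leq_addl _ _).
Qed.

(** Shapes in a finite type, so that they can index sums; [sumn la] is a crude bound on the
    parts. *)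
Definition shapef T : {ffun 'I_R -> 'I_C.+1} := [ffun i => inord (shape T (val i))].

Lemma parts_shapef T i : parts (shapef T) i = shape T i.
Proof.
case: (ltnP i R) => iR.
  rewrite (partsE _ (Ordinal iR)) ffunE inordK //= ltnS.
  exact: leq_trans (shape_le _ _) (nth_sumn _).
rewrite parts_out //; apply/esym/eqP; rewrite -leqn0.
by rewrite -(@nth_default _ 0%N la i iR) shape_le.
Qed.

Variable o : 'I_n.
Let N : nat := o.

(** For each box, whether N' and whether N occurs. *)
Definition newletters := {ffun box la -> bool * bool}.

Implicit Types (p : filling la n * newletters).

Definition low T : filling la n := [ffun c => [set a in T c | a.1 != o]].
Definition top T : newletters := [ffun c => ((o, false) \in T c, (o, true) \in T c)].
Definition join (p : filling la n * newletters) : filling la n :=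
  [ffun c => [set a : letter n | if a.1 == o then (if a.2 then (p.2 c).2 else (p.2 c).1)
                      else a \in p.1 c]].
Definition split T := (low T, top T).

Lemma mem_join p c a : (a \in join p c) =
  if a.1 == o then (if a.2 then (p.2 c).2 else (p.2 c).1) else a \in p.1 c.
Proof. by rewrite ffunE inE. Qed.

Lemma splitK T : join (split T) = T.
Proof.
apply/ffunP => c; apply/setP => a; rewrite mem_join /= !ffunE !inE.
by case: a => i b /=; case: eqVneq => [->|_]; [case: b|rewrite andbT].
Qed.

Lemma split_join p : (forall c a, a \in p.1 c -> a.1 != o) -> split (join p) = p.
Proof.
case: p => T s /= cl; congr (_, _); apply/ffunP => c; rewrite !ffunE.
  apply/setP => a; rewrite !inE /=; case: eqVneq => ao; rewrite ?andbT ?andbF //.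
  by apply/esym/negP => /cl; rewrite ao eqxx.
by rewrite !inE /= eqxx; case: (s c).
Qed.

Lemma low_clean T c a : a \in low T c -> a.1 != o.
Proof. by rewrite ffunE inE => /andP[]. Qed.

Definition has_new (p : filling la n * newletters) c : bool := (p.2 c).1 || (p.2 c).2.

Definition last_new (p : filling la n * newletters) : {ffun 'I_R -> bool} :=
  [ffun i => [exists c : box la,
     [&& tag c == i, (offset c).+1 == shape p.1 (val i) & has_new p c]]].

Variable mu : nat -> nat.
Hypothesis mu_la : forall i, (mu i <= nth 0%N la i)%N.
Hypothesis mu_strict : forall i, (0 < mu i.+1)%N -> (mu i.+1 < mu i)%N.

Definition new_ok nu (e : {ffun 'I_R -> bool}) (s : newletters) : bool :=
  [forall c : box la, box_ok (mu (brow c)) (mu (brow c).+1) (nu (brow c))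
     (nu (brow c).+1) (offset c) (e (tag c))
     (dg (brow c) (o, false)) (dg (brow c) (o, true)) (s c)].

Definition last_ok nu (e : {ffun 'I_R -> bool}) : bool :=
  [forall i : 'I_R, (nu i == 0%N) ==> ~~ e i].

Lemma has_newP p c : has_new p c ->
  exists a : letter n, [/\ a.1 = o, a \in join p c & (p.2 c).1 -> ~~ a.2].
Proof.
rewrite /has_new; case E1: ((p.2 c).1).
  by exists (o, false); rewrite mem_join /= eqxx E1.
by move=> /= E2; exists (o, true); rewrite mem_join /= eqxx E2.
Qed.

Lemma low_lt a : (a.1 < N.+1)%N -> a.1 != o -> (a.1 < N)%N.
Proof. by rewrite -(inj_eq val_inj) /= /N; lia. Qed.

(** Each clause of [box_ok] is a rule between a box and a neighbour, or the diagonal rule. The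
    second hypothesis means that [p.1] is free of N' and N, which makes the pair unique. *)
Lemma istab_split p : istab mu N.+1 (join p) -> split (join p) = p ->
  [/\ forall i, (shape p.1 i <= mu i)%N, istab (shape p.1) N p.1,
      last_ok (shape p.1) (last_new p) & new_ok (shape p.1) (last_new p) p.2].
Proof.
move=> [rl sh lt] sj; have cl c a : a \in p.1 c -> a.1 != o.
  by rewrite -{1}sj; exact: low_clean.
have sub c a : a \in p.1 c -> a \in join p c.
  by move=> h; rewrite mem_join (negPf (cl _ _ h)).
have ltN c a : a \in p.1 c -> (a.1 < N)%N.
  by move=> h; apply: low_lt (cl _ _ h); apply: lt (sub _ _ h).
have dc c d : brow d = brow c -> offset d = (offset c).+1 -> p.1 d != set0 -> p.1 c != set0.
  move=> bd od /set0Pn[a' a'd].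
  have : join p d != set0 by apply/set0Pn; exists a'; exact: sub.
  rewrite sh bd od => om; have : join p c != set0 by rewrite sh; lia.
  case/set0Pn => a ac; apply/set0Pn; exists a.
  have := rule_row rl bd od ac (sub _ _ a'd); rewrite letter_leE => le.
  have aN : (a.1 < N)%N by have := ltN _ _ a'd; case/orP: le => [|/andP[/eqP ->]] //; lia.
  move: ac; rewrite mem_join; case: eqVneq => // ao.
  by move: aN; rewrite ao /N ltnn.
have spec := shape_spec dc.
have jn c : (join p c != set0) = (p.1 c != set0) || has_new p c.
  apply/set0Pn/orP => [[a]|[/set0Pn[a /sub]|/has_newP[a [_ h _]]]]; last 2 first.
  - by exists a.
  - by exists a.
  rewrite mem_join; case: eqVneq => ao; last by left; apply/set0Pn; exists a.
  by rewrite /has_new; case: a.2 => ->; right; rewrite ?orbT.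
split.
- move=> i; apply/bigmax_leqP => c /andP[/eqP <- pc].
  by have := sh c; rewrite jn pc /= => <-.
- split=> //; split.
  + by move=> c d a a' bd od /sub h1 /sub h2; exact: rule_row h1 h2.
  + by move=> c d a a' bd od /sub h1 /sub h2; exact: rule_col h1 h2.
  + by move=> a c d a2 /sub h1 /sub h2; exact: rule_unprimed h1 h2.
  + by move=> a c d a2 /sub h1 /sub h2; exact: rule_primed h1 h2.
  + by move=> c a oc /sub h1; exact: rule_diag h1.
- apply/forallP => i; apply/implyP => /eqP e0; rewrite ffunE.
  by apply/existsP => -[c /and3P[_ /eqP]]; rewrite e0.
have pair c d : brow d = brow c -> offset d = (offset c).+1 -> has_new p c -> ~~ (p.2 d).1.
  move=> bd od /has_newP[a [ao ac a2]]; apply/negP => pd.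
  have od' : (o, false) \in join p d by rewrite mem_join /= eqxx.
  have := rule_row rl bd od ac od'; rewrite letter_leE ao ltnn eqxx /= implybF => na2.
  have ea : a = (o, false) by case: a ao na2 {ac a2} => i [] //= ->.
  rewrite ea in ac; have := @rule_primed _ rl (o, false) c d isT ac od' (esym bd).
  by move=> cd; move: od; rewrite cd; lia.
(* A box with a new letter cannot precede one that holds a smaller letter. *)
have nlt c d : has_new p c -> p.1 d != set0 ->
   (forall a a', a \in join p c -> a' \in join p d -> letter_le a a') -> False.
  move=> /has_newP[b [bo bc _]] /set0Pn[a' a'd] /(_ _ _ bc (sub _ _ a'd)).
  rewrite letter_leE bo; have := ltN _ _ a'd; rewrite /N => h.
  by case/orP => [|/andP[/eqP e _]]; [lia|rewrite -e ltnn in h].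
apply/forallP => c; rewrite /box_ok -/(has_new p c).
have shc := sh c; rewrite jn spec in shc.
repeat (apply/andP; split).
- by rewrite orbC shc.
- apply/implyP => hc; rewrite leqNgt; apply/negP => h.
  have [d [bd od]] : exists d : box la, brow d = brow c /\ offset d = (offset c).+1.
    by apply: box_at; apply: leq_trans h (shape_le _ _).
  apply: (nlt c d) => //; first by rewrite spec bd od.
  by move=> a a'; exact: rule_row.
- apply/implyP => hc; apply/negP => /andP[k0 kq].
  have [d [bd od]] : exists d : box la, brow d = (brow c).+1 /\ offset d = (offset c).-1.
    by apply: box_at; apply: leq_trans (shape_le p.1 _); rewrite prednK.
  apply: (nlt c d) => //; first by rewrite spec bd od prednK.
  by move=> a a'; apply: rule_col => //; rewrite od prednK.
(* Below an N only N could stand, which would repeat it in the column. *)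
- apply/implyP => hu; apply/negP => /andP[k0 kq].
  have [d [bd od]] : exists d : box la, brow d = (brow c).+1 /\ offset d = (offset c).-1.
    by apply: box_at; apply: leq_trans (mu_la _); rewrite prednK.
  have : join p d != set0 by rewrite sh bd od prednK.
  case/set0Pn => a' a'd.
  have oc : (o, true) \in join p c by rewrite mem_join /= eqxx.
  have := rule_col rl bd _ oc a'd; rewrite od prednK // => /(_ erefl).
  rewrite letter_leE /= => /orP[h|/andP[/eqP ao a2]].
    by have := lt _ _ a'd; rewrite /N ltnS leqNgt h.
  have ea : a' = (o, true) by case: a' ao a2 {a'd} => i b /= <- ->.
  rewrite ea in a'd; have : c = d by apply: rule_unprimed oc a'd _ => //; rewrite /bcol bd od; lia.
  by move=> cd; move: bd; rewrite cd; lia.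
- apply/implyP => /eqP oc; apply/andP; split; apply/implyP => h;
    by apply: (rule_diag rl oc); rewrite mem_join /= eqxx.
(* An N' beyond the first new box has a new letter on its left, against [pair]. *)
- apply/implyP => hp; rewrite leqNgt; apply/negP => h.
  have [d [bd od]] : exists d : box la, brow d = brow c /\ offset d = (offset c).-1.
    by apply: box_at; have := offset_lt c; lia.
  have hd : has_new p d.
    have := sh d; rewrite jn spec bd od.
    have -> : ((offset c).-1 < shape p.1 (brow c))%N = false by lia.
    move=> /= ->; have : (offset c < mu (brow c))%N by rewrite -shc /has_new hp orbT.
    lia.
  by have := pair d c (esym bd) _ hd; rewrite hp od prednK //; [move/(_ erefl)|lia].
- apply/implyP => /eqP kc; apply/eqP; rewrite ffunE.
  apply/idP/existsP => [hc|[d /and3P[/eqP td /eqP od hd]]].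
    by exists c; rewrite eqxx hc andbT /=; apply/eqP.
  rewrite (@box_ext c d) //; first by rewrite /brow td.
  by apply: succn_inj; rewrite od -kc.
- apply/implyP => /andP[/eqP kc]; rewrite ffunE.
  case/existsP => d /and3P[/eqP td /eqP od hd].
  by apply: (pair d c) => //; [rewrite /brow td|rewrite od -kc].
Qed.

(** A column that meets mu in two rows meets it in all rows between; the column rule for N thus
    reduces to adjacent boxes. *)
Lemma mu_chain i j : (0 < mu (i + j))%N -> (mu (i + j) + j <= mu i)%N.
Proof.
elim: j => [|j IH]; first by rewrite !addn0.
rewrite addnS => h; have := mu_strict h => h'.
by have := IH (leq_trans h (ltnW h')); lia.
Qed.

(** The local conditions also suffice, and nu and e are recovered from the pair, so they index a
    partition of the tableaux. *)
Lemma istab_join nu e p :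
  (forall i, (nu i <= mu i)%N) -> istab nu N p.1 -> last_ok nu e -> new_ok nu e p.2 ->
  [/\ istab mu N.+1 (join p), split (join p) = p, forall i, shape p.1 i = nu i
    & last_new p = e].
Proof.
move=> numu [rl sh lt] /forallP eok /forallP nok.
have cl c a : a \in p.1 c -> a.1 != o.
  by move=> /lt; rewrite -(inj_eq val_inj) /= /N; lia.
have shE := shape_uniq sh (fun i => leq_trans (numu i) (mu_la i)).
have nok' c : box_ok (mu (brow c)) (mu (brow c).+1) (nu (brow c))
     (nu (brow c).+1) (offset c) (e (tag c))
     (dg (brow c) (o, false)) (dg (brow c) (o, true)) (p.2 c) := nok c.
have sup c : has_new p c || (offset c < nu (brow c))%N = (offset c < mu (brow c))%N.
  by have := nok' c; case/andP => /eqP.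
have right c : has_new p c -> (nu (brow c) <= (offset c).+1)%N.
  by move=> h; have := nok' c; case/andP => _ /andP[/implyP /(_ h)].
have below c : has_new p c -> ~~ ((0 < offset c) && (offset c <= nu (brow c).+1))%N.
  by move=> h; have := nok' c; do 2 case/andP => _; case/andP => /implyP /(_ h).
have belowu c : (p.2 c).2 -> ~~ ((0 < offset c) && (offset c <= mu (brow c).+1))%N.
  by move=> h; have := nok' c; do 3 case/andP => _; case/andP => /implyP /(_ h).
have dok c : offset c = 0%N -> ((p.2 c).1 -> dg (brow c) (o, false)) /\
    ((p.2 c).2 -> dg (brow c) (o, true)).
  move=> oc; have := nok' c; do 4 case/andP => _; case/andP; rewrite oc /=.
  by case/andP => /implyP h1 /implyP h2.
have first c : (p.2 c).1 -> (offset c <= nu (brow c))%N.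
  by move=> h; have := nok' c; do 5 case/andP => _; case/andP => /implyP /(_ h).
have lastE c : (offset c).+1 = nu (brow c) -> has_new p c = e (tag c).
  by move=> h; have := nok' c; do 6 case/andP => _; case/andP; rewrite h eqxx /= => /eqP.
have firstE c : offset c = nu (brow c) -> e (tag c) -> ~~ (p.2 c).1.
  move=> h h'; have := nok' c; do 7 case/andP => _.
  by rewrite h eqxx h'.
have row_tag c d : brow d = brow c -> tag d = tag c by exact: val_inj.
have pair c d : brow d = brow c -> offset d = (offset c).+1 -> has_new p c -> ~~ (p.2 d).1.
  move=> bd od hc; apply/negP => hp.
  have h1 := right _ hc; have h2 := first _ hp; rewrite bd od in h2.
  have e1 : (offset c).+1 = nu (brow c) by lia.
  have := firstE d; rewrite (row_tag _ _ bd) -(lastE c e1) hc hp bd od e1.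
  by move=> /(_ erefl isT).
have new c a : a \in join p c -> a.1 = o -> has_new p c.
  by rewrite mem_join => + ao; rewrite ao eqxx /has_new; case: a.2 => ->; rewrite ?orbT.
have old c a : a \in join p c -> a.1 != o -> a \in p.1 c.
  by rewrite mem_join => + /negPf ao; rewrite ao.
have oldnu c a : a \in p.1 c -> (offset c < nu (brow c))%N.
  by move=> ac; rewrite -sh; apply/set0Pn; exists a.
have lt_old a a' : (a.1 < N)%N -> a'.1 = o -> letter_le a a'.
  by move=> h e'; rewrite letter_leE e' h.
split.
- split; last 2 first.
  + move=> c; rewrite -sup.
    apply/set0Pn/orP => [[a ac]|[/has_newP[a [_ h _]]|]]; last 2 first.
    * by exists a.
    * rewrite -sh => /set0Pn[a ac]; exists a.
      by rewrite mem_join (negPf (cl _ _ ac)).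
    * case: (eqVneq a.1 o) => ao; first by left; apply: new ac ao.
      by right; apply: oldnu (old _ _ ac ao).
  + move=> c a ac; case: (eqVneq a.1 o) => [->|ao]; first by [].
    by rewrite ltnS ltnW // (lt _ _ (old _ _ ac ao)).
  split.
  + move=> c d a a' bd od ac a'd.
    case: (eqVneq a.1 o) => ao; case: (eqVneq a'.1 o) => ao'.
    * have np := pair _ _ bd od (new _ _ ac ao).
      rewrite letter_leE ao ao' ltnn eqxx /=; apply/implyP => _.
      by move: a'd; rewrite mem_join ao' eqxx; case: a'.2 => //; rewrite (negPf np).
    * have := right _ (new _ _ ac ao); have := oldnu _ _ (old _ _ a'd ao').
      by rewrite bd od; lia.
    * exact: lt_old (lt _ _ (old _ _ ac ao)) ao'.
    * exact: (rule_row rl bd od (old _ _ ac ao) (old _ _ a'd ao')).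
  + move=> c d a a' bd od ac a'd.
    case: (eqVneq a.1 o) => ao; case: (eqVneq a'.1 o) => ao'.
    * rewrite letter_leE ao ao' ltnn eqxx /=; apply/implyP => a2.
      move: ac; rewrite mem_join ao eqxx a2 => /belowu.
      have := sup d; rewrite (new _ _ a'd ao') bd /= => /esym.
      by rewrite od; lia.
    * have := below _ (new _ _ ac ao); have := oldnu _ _ (old _ _ a'd ao').
      by rewrite bd od; lia.
    * exact: lt_old (lt _ _ (old _ _ ac ao)) ao'.
    * exact: (rule_col rl bd od (old _ _ ac ao) (old _ _ a'd ao')).
  + move=> a c d a2 ac ad bcd.
    case: (eqVneq a.1 o) => ao; last first.
      exact: (rule_unprimed rl a2 (old _ _ ac ao) (old _ _ ad ao) bcd).
    have key (c' d' : box la) : a \in join p c' -> a \in join p d' -> bcol c' = bcol d' ->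
        (brow c' < brow d')%N -> False.
      rewrite {1}mem_join ao eqxx a2 => /belowu h h2; rewrite /bcol => bcd' lt'.
      have := sup d'; rewrite (new _ _ h2 ao) /= => /esym hd.
      have := @mu_chain (brow c').+1 (brow d' - (brow c').+1); rewrite subnKC // => hm.
      have := hm (leq_ltn_trans (leq0n _) hd) => hm'.
      by move: h; apply/negP/negPn; lia.
    case: (ltngtP (brow c) (brow d)) => [h|h|h].
    * by case: (key c d).
    * by case: (key d c).
    * by apply: box_ext => //; move: bcd; rewrite /bcol h; lia.
  + move=> a c d a2 ac ad bcd.
    case: (eqVneq a.1 o) => ao; last first.
      exact: (rule_primed rl a2 (old _ _ ac ao) (old _ _ ad ao) bcd).
    have key (c' d' : box la) : a \in join p c' -> a \in join p d' -> brow c' = brow d' ->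
        (offset c' < offset d')%N -> False.
      move=> h1; rewrite {1}mem_join ao eqxx (negPf a2) => h2 bcd' lt'.
      have f := first _ h2; have r := right _ (new _ _ h1 ao); rewrite bcd' in r.
      have := pair c' d' (esym bcd'); rewrite (new _ _ h1 ao) h2.
      have -> : offset d' = (offset c').+1 by lia.
      by move=> /(_ erefl isT).
    case: (ltngtP (offset c) (offset d)) => [h|h|h].
    * by case: (key c d).
    * by case: (key d c).
    * exact: box_ext.
  + move=> c a oc ac; case: (eqVneq a.1 o) => ao; last first.
      exact: (rule_diag rl oc (old _ _ ac ao)).
    have [h1 h2] := dok c oc.
    move: ac; rewrite mem_join ao eqxx.
    by case: a ao => i [] /= ->.
- exact: split_join.
- exact: shE.
- apply/ffunP => i; rewrite ffunE.
  case: (posnP (nu i)) => [n0|n0].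
    have /implyP := eok i; rewrite n0 eqxx => /(_ isT) /negPf ->.
    by apply/existsP => -[c /and3P[_ /eqP]]; rewrite shE n0.
  have [c [bc oc]] : exists c : box la, brow c = i /\ offset c = (nu i).-1.
    by apply: box_at; have := mu_la i; have := numu i; lia.
  have ti : tag c = i by exact: val_inj.
  have ec : (offset c).+1 = nu (brow c) by rewrite bc oc prednK.
  rewrite -{3}ti -(lastE c ec).
  apply/existsP/idP => [[d /and3P[/eqP td /eqP od hd]]|hc].
    rewrite (@box_ext c d) //; first by rewrite /brow td ti.
    by apply: succn_inj; rewrite od shE oc prednK.
  by exists c; rewrite ti eqxx hc shE andbT /=; apply/eqP; rewrite ec bc.
Qed.

End Splitting.

Section TableauSums.
Variables (la : seq nat) (n : nat) (dg : nat -> letter n -> bool).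
Variables (F : fieldType) (beta : F) (x : n.-tuple F) (bs : nat -> F).
Implicit Types (c d : box la) (a : letter n) (T : filling la n) (mu nu : nat -> nat).
Let R := size la.
Let C := sumn la.

(** Boxes outside the shape are empty and weigh 1, since the predecessor of 0 is 0. *)
Definition cell_weight c (A : {set letter n}) : F :=
  beta ^+ #|A|.-1 * \prod_(a in A) box_weight beta x bs c a.

Definition tab_sum nu (N : nat) : F :=
  \sum_(T : filling la n | `[< istab dg nu N T >]) \prod_c cell_weight c (T c).

Section OneLetter.
Variables (o : 'I_n) (mu : nat -> nat).
Hypothesis mu_la : forall i, (mu i <= nth 0%N la i)%N.
Hypothesis mu_strict : forall i, (0 < mu i.+1)%N -> (mu i.+1 < mu i)%N.
Let t := tnth x o.

Lemma cell_weight_join (p : filling la n * newletters la) c :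
  (forall a, a \in p.1 c -> a.1 != o) ->
  cell_weight c (join o p c) =
  cell_weight c (p.1 c) * new_weight beta bs t (p.1 c != set0) (offset c) (p.2 c).
Proof.
move=> cl; rewrite /cell_weight.
pose S : {set letter n} := [set a | (a.1 == o) && (if a.2 then (p.2 c).2 else (p.2 c).1)].
have jE : join o p c = p.1 c :|: S.
  apply/setP => a; rewrite mem_join !inE; case: eqVneq => ao; last by rewrite orbF.
  have -> : (a \in p.1 c) = false by apply/negP => /cl; rewrite ao eqxx.
  by [].
have dj : [disjoint p.1 c & S].
  rewrite disjoint_subset; apply/subsetP => a /cl ao.
  by rewrite !inE (negPf ao).
have SE : S = match p.2 c with
  | (true, true) => [set (o, false); (o, true)]
  | (true, false) => [set (o, false)]
  | (false, true) => [set (o, true)]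
  | (false, false) => set0 end.
  apply/setP => -[i b]; rewrite !inE /=.
  by case: (p.2 c) => [[] []]; case: b; rewrite !inE ?xpair_eqE ?eqxx ?andbT ?andbF ?orbF.
have oo : ((o, false) : letter n) \notin [set (o, true)] by rewrite inE xpair_eqE andbF.
have Sc : #|S| = ((p.2 c).1 + (p.2 c).2)%N.
  by rewrite SE; case: (p.2 c) => [[] []]; rewrite ?cardsU1 ?oo ?cards1 ?cards0.
have Sp : \prod_(a in S) box_weight beta x bs c a =
   (if (p.2 c).1 then vw beta bs t (offset c) else 1) *
   (if (p.2 c).2 then uw beta bs t (offset c) else 1).
  rewrite SE; case: (p.2 c) => [[] []] /=.
  - by rewrite big_setU1 //= big_set1.
  - by rewrite big_set1 mulr1.
  - by rewrite big_set1 mul1r.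
  - by rewrite big_set0 mulr1.
have -> : \prod_(a in join o p c) box_weight beta x bs c a =
    \prod_(a in p.1 c) box_weight beta x bs c a * \prod_(a in S) box_weight beta x bs c a.
  by rewrite -bigU //=; apply: eq_bigl => a; rewrite jE !inE.
rewrite jE Sp cardsU (_ : p.1 c :&: S = set0); last first.
  by apply/eqP; rewrite setI_eq0.
rewrite cards0 subn0 Sc /new_weight -cards_eq0.
case: (posnP #|p.1 c|) => [->|c0].
  by rewrite add0n subn1 expr0 mul1r /=; ring.
have -> : ((#|p.1 c| + ((p.2 c).1 + (p.2 c).2)).-1 =
  #|p.1 c|.-1 + ((p.2 c).1 + (p.2 c).2))%N by lia.
rewrite subn0 exprD; ring.
Qed.

(** For fixed e the boxes are independent, and each flag concerns a single row, so both sums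
    distribute over products. *)
Lemma sum_new nu :
  \sum_(e : {ffun 'I_R -> bool} | last_ok nu e)
    \sum_(s : newletters la | new_ok dg o mu nu e s)
      \prod_c new_weight beta bs t (offset c < nu (brow c))%N (offset c) (s c) =
  \prod_(0 <= i < R) row_sum beta bs t (nth 0%N la i) (mu i) (mu i.+1) (nu i) (nu i.+1)
    (dg i (o, false)) (dg i (o, true)).
Proof.
pose h (i : nat) (e : bool) := ((nu i == 0%N) ==> ~~ e)%:R *
    \prod_(0 <= k < nth 0%N la i) box_sum beta bs t (mu i) (mu i.+1) (nu i) (nu i.+1) k e
    (dg i (o, false)) (dg i (o, true)).
transitivity (\prod_(i < R) \sum_(e : bool) h i e); last first.
  by rewrite big_mkord.
rewrite bigA_distr_bigA /= big_mkcond; apply: eq_bigr => e _.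
rewrite /h big_split /=.
have -> : \prod_(i < R) ((nu i == 0%N) ==> ~~ e i)%:R = (last_ok nu e)%:R :> F.
  case: (boolP (last_ok nu e)) => [/forallP ok|].
    by rewrite big1 // => i _; rewrite ok.
  by rewrite negb_forall => /existsP[i /negPf i0]; rewrite (bigD1 i) //= i0 mul0r.
case: ifP => _; last by rewrite mul0r.
rewrite mul1r.
pose g c (pu : bool * bool) : F :=
  if box_ok (mu (brow c)) (mu (brow c).+1) (nu (brow c)) (nu (brow c).+1) (offset c)
     (e (tag c)) (dg (brow c) (o, false)) (dg (brow c) (o, true)) pu
  then new_weight beta bs t (offset c < nu (brow c))%N (offset c) pu else 0.
transitivity (\sum_(s : newletters la) \prod_c g c (s c)).
  rewrite big_mkcond; apply: eq_bigr => s _.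
  case: ifP => [/forallP ok|/negbT].
    by apply: eq_bigr => c _; rewrite /g ok.
  rewrite negb_forall => /existsP[c /negPf c0].
  by rewrite (bigD1 c) //= /g c0 mul0r.
rewrite -bigA_distr_bigA.
under [RHS]eq_bigr do rewrite big_mkord.
rewrite sig_big_dep; apply: eq_bigr => c _.
by rewrite /box_sum [RHS]big_mkcond.
Qed.

Theorem tab_sum_branching :
  tab_sum mu o.+1 = \sum_(nu : {ffun 'I_R -> 'I_C.+1} | [forall i, (nu i <= mu i)%N])
    tab_sum (parts nu) o *
    \prod_(0 <= i < R) row_sum beta bs t (nth 0%N la i) (mu i) (mu i.+1)
       (parts nu i) (parts nu i.+1) (dg i (o, false)) (dg i (o, true)).
Proof.
rewrite {1}/tab_sum (reindex_onto (join o) (split o)); last by move=> T _; exact: splitK.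
(* The fibres fix the shape of the smaller letters and the row flags. *)
rewrite (partition_big (fun p : filling la n * newletters la => (shapef p.1, last_new p)) xpredT) //=.
pose G (nu : {ffun 'I_R -> 'I_C.+1}) (e : {ffun 'I_R -> bool}) :=
  \sum_(p : filling la n * newletters la |
    `[< istab dg mu o.+1 (join o p) >] && (split o (join o p) == p) &&
    ((shapef p.1, last_new p) == (nu, e))) \prod_c cell_weight c (join o p c).
transitivity (\sum_(j : {ffun 'I_R -> 'I_C.+1} * {ffun 'I_R -> bool}) G j.1 j.2).
  by apply: eq_bigr => -[].
rewrite -(pair_bigA _ G) /= /G.
rewrite [RHS]big_mkcond; apply: eq_bigr => nu _.
have key e (p : filling la n * newletters la) :
  `[< istab dg mu o.+1 (join o p) >] && (split o (join o p) == p) &&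
    ((shapef p.1, last_new p) == (nu, e)) =
  [forall i, (nu i <= mu i)%N] && last_ok (parts nu) e &&
  (`[< istab dg (parts nu) o p.1 >] && new_ok dg o mu (parts nu) e p.2).
  have numu : (forall i, parts nu i <= mu i)%N <-> [forall i, (nu i <= mu i)%N].
    split=> [h|/forallP h i]; first by apply/forallP => i; rewrite -partsE.
    case: (ltnP i R) => iR; last by rewrite parts_out.
    by rewrite (partsE _ (Ordinal iR)) (h (Ordinal iR)).
  apply/idP/idP.
    case/andP=> /andP[/asboolP ist /eqP sj] /eqP[e1 e2].
    have [h1 h2 h3 h4] := istab_split mu_la ist sj.
    have nuE : parts nu = shape p.1 by apply/funext => i; rewrite -e1 parts_shapef.
    rewrite nuE -e2 h3 h4 andbT; apply/andP; split; last by apply/andP; split=> //; apply/asboolP.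
    by apply/numu => i; rewrite nuE.
  case/andP=> /andP[/numu h1 h2] /andP[/asboolP h3 h4].
  have [i1 i2 i3 i4] := istab_join mu_la mu_strict h1 h3 h2 h4.
  rewrite i2 i4 eqxx andbT; apply/andP; split; first exact/asboolP.
  rewrite xpair_eqE eqxx andbT; apply/eqP/ffunP => i; apply: val_inj.
  by rewrite -[LHS]partsE -[RHS]partsE parts_shapef i3.
under eq_bigr => e _ do under eq_bigl => p do rewrite key.
case: ifP => numu; last first.
  by rewrite big1 // => e _; apply: big_pred0 => p.
rewrite -sum_new mulr_sumr [RHS]big_mkcond; apply: eq_bigr => e _.
case: ifP => lok; last by apply: big_pred0.
rewrite /tab_sum big_distrlr /= pair_big; apply: eq_bigr => -[T s] /= /andP[/asboolP[rl sh lt] _].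
rewrite -big_split; apply: eq_bigr => c _ /=.
rewrite cell_weight_join /= ?sh // => a /lt.
by rewrite -(inj_eq val_inj) => h; rewrite ltn_eqF.
Qed.

End OneLetter.
End TableauSums.

(** * Comparison *)

Section MainInduction.
Variables (la : seq nat) (n : nat) (dg : nat -> letter n -> bool).
Variables (F : fieldType) (beta : F) (x : n.-tuple F) (bs : nat -> F).
Hypothesis charF0 : forall m, (m.+1%:R : F) != 0.
Hypothesis bs0 : forall k, 1 + beta * bs k != 0.
Local Notation X := (fun k => nth 0 x k).
Hypothesis xn : nondeg beta n X.
Variable (H : nat -> F -> F).
Hypothesis HE : forall k z, (0 < k)%N -> H k.+1 z = oplus beta z (bs k) * H k z.
Let R := size la.
Let C := sumn la.

Definition diag_weight (a : nat) (o : 'I_n) : F :=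
  let t := tnth x o in
  (dg a (o, false))%:R * vw beta bs t 0 + (dg a (o, true))%:R * uw beta bs t 0
  + (dg a (o, false) && dg a (o, true))%:R * (beta * uw beta bs t 0 * vw beta bs t 0).

Hypothesis diagP : forall (a : nat) (o : 'I_n) y, (a <= o)%N ->
  nondeg beta (o - a) y -> away (o - a) y (tnth x o) ->
  diag_id beta (H 1%N) (diag_weight a o) (o - a) y (tnth x o).

Lemma tab_sum0 mu N : (forall i, mu i = 0%N) -> tab_sum la dg beta x bs mu N = 1 :> F.
Proof.
move=> mu0; rewrite /tab_sum (big_pred1 [ffun=> set0]).
  by rewrite big1 // => c _; rewrite ffunE /cell_weight cards0 big_set0 expr0 mulr1.
move=> T; apply/asboolP/eqP => [[_ sh _]|->].
  by apply/ffunP => c; rewrite ffunE; apply/eqP/negPn; rewrite sh mu0.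
split; first split.
- by move=> c d a a' _ _; rewrite ffunE inE.
- by move=> c d a a' _ _; rewrite ffunE inE.
- by move=> a c d _; rewrite ffunE inE.
- by move=> a c d _; rewrite ffunE inE.
- by move=> c a _; rewrite ffunE inE.
- by move=> c; rewrite ffunE eqxx mu0.
- by move=> c a; rewrite ffunE inE.
Qed.

Lemma symP0 mu N (y : nat -> F) : symP beta H mu 0 N y = 1.
Proof.
rewrite /symP /Sym /Phi subn0.
under eq_bigr do rewrite !big_geq // mulr1.
rewrite sumr_const card_Sn mulVf //.
by case: N`! (fact_gt0 N) => // k _; exact: charF0.
Qed.

(** Lets nu run over all bounded sequences rather than those inside mu. *)
Lemma shiftrow_weight_eq0 N a (y : nat -> F) mu om i m d : (mu i < m)%N ->
  shiftrow_weight beta bs N a y mu om i m d = 0.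
Proof.
move=> h; rewrite /shiftrow_weight /rowwt /lastwt.
case: ifP => _; first by rewrite [(m <= mu i)%N]leqNgt h andbF.
case: eqP => [<-|_]; first by rewrite leqNgt h.
by have -> : (m == 0%N) = false by lia.
Qed.

(** Induction on N for all shapes at once, as removing a letter changes the shape and possibly the
    number r of rows. *)
Theorem tab_sumE N mu r : (N <= n)%N -> (forall i, (mu i <= nth 0%N la i)%N) ->
  (forall i, (0 < mu i)%N = (i < r)%N) ->
  (forall i, (0 < mu i.+1)%N -> (mu i.+1 < mu i)%N) ->
  tab_sum la dg beta x bs mu N = if (r <= N)%N then symP beta H mu r N X else 0.
Proof.
elim: N mu r => [|N IH] mu [|a] Nn mu_la mu_r mu_strict.
- by rewrite symP0 tab_sum0 // => i; have := mu_r i; lia.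
- have [c [bc oc]] : exists c : box la, brow c = 0%N /\ offset c = 0%N.
    by apply: box_at; have := mu_la 0%N; have := mu_r 0%N; lia.
  rewrite /tab_sum big_pred0 // => T; apply/negbTE/negP => /asboolP[_ sh lt].
  have : T c != set0 by rewrite sh bc oc mu_r.
  by case/set0Pn => a' /lt.
- by rewrite symP0 tab_sum0 // => i; have := mu_r i; lia.
pose o := Ordinal Nn; pose t := tnth x o.
have tE : t = X N by rewrite /t (tnth_nth 0).
have mua : (0 < mu a)%N by rewrite mu_r.
have aR : (a < size la)%N.
  by rewrite ltnNge; apply/negP => h; have := mu_la a; rewrite nth_default //; lia.
have mu_strict' i : (i < a)%N -> (mu i.+1 < mu i)%N.
  by move=> ia; apply: mu_strict; rewrite mu_r.
rewrite (@tab_sum_branching la n dg F beta x bs o mu) //.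
pose rw := shiftrow_weight beta bs N a X mu (diag_weight a o).
transitivity (\sum_(nu : {ffun 'I_R -> 'I_C.+1})
    (\prod_(0 <= i < R) rw i (parts nu i) (parts nu i.+1 < mu i.+1)%N) *
    if (a <= N)%N then symP_rows beta H N a X (parts nu) else 0).
  rewrite big_mkcond; apply: eq_bigr => nu _.
  case: ifP => [/forallP numu|/negbT]; last first.
    rewrite negb_forall => /existsP[i]; rewrite -ltnNge -(partsE nu) => h.
    by rewrite [\prod_(_ <= _ < _) _]big_mkord (bigD1 i) //= /rw shiftrow_weight_eq0 // !mul0r.
  have {}numu i : (parts nu i <= mu i)%N.
    case: (ltnP i R) => iR; last by rewrite parts_out.
    by rewrite (partsE _ (Ordinal iR)) (numu (Ordinal iR)).
  rewrite mulrC.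
  have -> : \prod_(0 <= i < size la) row_sum beta bs t (nth 0%N la i) (mu i) (mu i.+1)
       (parts nu i) (parts nu i.+1) (dg i (o, false)) (dg i (o, true)) =
     \prod_(0 <= i < R) rw i (parts nu i) (parts nu i.+1 < mu i.+1)%N.
    apply: eq_big_nat => i iR; rewrite /rw /shiftrow_weight -tE.
    have mui : ~~ (i < a.+1)%N -> mu i = 0%N by move=> h; have := mu_r i; lia.
    case: (ltngtP i a) => [ia|ai|->].
    - by rewrite row_sum_inner // mu_r mu_strict' // andbT.
    - rewrite row_sum_empty //; last by apply: mui; lia.
      by have := numu i; rewrite mui ?leqn0 => [->|]; rewrite -?leqNgt.
    - by rewrite row_sum_last_row //; have := mu_r a.+1; lia.
  case: (eqVneq (\prod_(0 <= i < R) rw i (parts nu i) (parts nu i.+1 < mu i.+1)%N) 0) =>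
    [->|W0]; first by rewrite !mul0r.
  congr (_ * _).
  (* [IH] asks for a strict nu. If nu_(i+1) = nu_i, interlacing makes both equal to mu_(i+1); the
     constraint then fails and the weight of row i is 0. *)
  have step i : (i < a)%N -> (mu i.+1 <= parts nu i)%N /\ (parts nu i.+1 < parts nu i)%N.
    move=> ia; have iR : (i < R)%N by exact: ltn_trans aR.
    have : rw i (parts nu i) (parts nu i.+1 < mu i.+1)%N != 0.
      by apply: contraNneq W0 => e; rewrite big_mkord (bigD1 (Ordinal iR)) //= e mul0r.
    rewrite /rw /shiftrow_weight ia /rowwt numu andbT.
    case: (leqP (mu i.+1) (parts nu i)) => [h1|_]; last by rewrite eqxx.
    move=> nz; split=> //; rewrite ltn_neqAle (leq_trans (numu i.+1) h1) andbT.
    apply: contraNneq nz => e.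
    have e2 : mu i.+1 = parts nu i by have := numu i.+1; lia.
    have ms := mu_strict' i ia.
    rewrite e -e2 ltnn eqxx.
    have -> : (mu i.+1 == mu i) = false by lia.
    by rewrite !mul0r.
  have nu_strict i : (0 < parts nu i.+1)%N -> (parts nu i.+1 < parts nu i)%N.
    move=> h; case: (ltnP i a) => ia; first by case: (step i ia).
    by have := mu_r i.+1; have := numu i.+1; lia.
  have nu_la i : (parts nu i <= nth 0%N la i)%N := leq_trans (numu i) (mu_la i).
  have nu_r : forall i, (0 < parts nu i)%N = (i < (if parts nu a == 0%N then a else a.+1))%N.
    move=> i; case: (ltngtP i a) => [ia|ai|->].
    - have [h _] := step i ia; have : (0 < mu i.+1)%N by rewrite mu_r.
      by case: ifP => _; lia.
    - by have := numu i; have := mu_r i; case: ifP => _; lia.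
    - by case: eqP => [->|]; lia.
  rewrite (IH _ _ (ltnW Nn) nu_la nu_r nu_strict) /symP_rows.
  case: eqP => _; first by [].
  by case: (ltnP a N) => aN; [rewrite ltnW|case: ifP].
rewrite ltnS; case: leqP => aN; last by rewrite big1 // => nu _; rewrite mulr0.
apply: (symP_branching charF0 bs0 HE) => //.
- exact: nondeg_leq xn.
- by move=> i; exact: leq_trans (mu_la i) (nth_sumn _ _).
- by move=> y yn; rewrite -tE => ya; exact: (diagP (o := o)).
Qed.

End MainInduction.

(** * Return to the defined functions and tableaux *)

Lemma symmetrizationE (F : fieldType) (beta : F) (head H : nat -> F -> F) (la : seq nat)
    (n : nat) (x : n.-tuple F) : (size la <= n)%N -> (0%N \notin la) ->
  (forall l y, (0 < l)%N -> head l y = H l y) ->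
  symmetrization beta head la x =
  symP beta H (nth 0%N la) (size la) n (fun k => nth 0 x k).
Proof.
move=> lan la0 hH; rewrite /symmetrization /symP /Sym; congr (_ * _).
apply: eq_bigr => w _; set X := fun k => nth 0 x k.
have yE (i : 'I_n) : tnth x (w i) = act w X i by rewrite actE /X (tnth_nth 0).
congr (_ * _).
  rewrite big_mkord (big_ord_widen n (fun i => H (nth 0%N la i) (act w X i)) lan).
  apply: eq_bigr => i il; rewrite yE hH // lt0n.
  by apply: contraNneq la0 => <-; exact: mem_nth.
rewrite /Phi big_mkord.
rewrite (big_ord_widen n (fun i => \prod_(i.+1 <= j < n) phi beta (act w X i) (act w X j)) lan).
apply: eq_bigr => i _; rewrite big_geq_mkord.
by apply: eq_bigr => j _; rewrite !yE phi_def.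
Qed.

Section TableauxToSums.
Variables (la : seq nat) (n : nat) (dg : nat -> letter n -> bool).
Variables (F : fieldType) (beta : F) (x : n.-tuple F) (bs : nat -> F).

Lemma card_box : #|box la| = sumn la.
Proof.
rewrite card_tagged sumnE big_map big_enum /=.
under eq_bigr do rewrite card_ord.
by rewrite sumnE (big_nth 0%N) big_mkord.
Qed.

Lemma istabP (T : filling la n) :
  `[< istab dg (nth 0%N la) n T >] =
  tableau T && [forall c, diagonal c ==> [forall a in T c, dg (brow c) a]].
Proof.
have diagE (c : box la) : diagonal c = (offset c == 0%N).
  by rewrite /diagonal /bcol; lia.
apply/asboolP/andP.
  case=> [[r1 r2 r3 r4 r5] sh _]; split; last first.
    apply/forallP => c; rewrite diagE; apply/implyP => /eqP oc.
    by apply/forall_inP => a; exact: r5.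
  apply/and5P; split.
  - by apply/forallP => c; rewrite sh offset_lt.
  - apply/forallP => c; apply/forallP => d; apply/implyP => /andP[/eqP bd /eqP cd].
    apply/forall_inP => a ac; apply/forall_inP => a' a'd.
    by apply: r1 ac a'd => //; move: cd; rewrite /bcol bd; lia.
  - apply/forallP => c; apply/forallP => d; apply/implyP => /andP[/eqP bd /eqP cd].
    apply/forall_inP => a ac; apply/forall_inP => a' a'd.
    by apply: r2 ac a'd => //; move: cd; rewrite /bcol bd; lia.
  - apply/forallP => a; apply/forallP => c; apply/forallP => d; apply/implyP.
    by case/and4P => a2 ac ad /eqP cd; apply/eqP; exact: r3 ac ad cd.
  - apply/forallP => a; apply/forallP => c; apply/forallP => d; apply/implyP.
    by case/and4P => a2 ac ad /eqP cd; apply/eqP; exact: r4 ac ad cd.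
case=> /and5P[/forallP t1 /forallP t2 /forallP t3 /forallP t4 /forallP t5] /forallP t6.
split; first split.
- move=> c d a a' bd od ac a'd.
  have /implyP h := forallP (t2 c) d.
  have : max_le_min (T c) (T d).
    by apply: h; rewrite bd eqxx /= /bcol bd od; lia.
  by move=> /forall_inP /(_ _ ac) /forall_inP /(_ _ a'd).
- move=> c d a a' bd od ac a'd.
  have /implyP h := forallP (t3 c) d.
  have : max_le_min (T c) (T d).
    by apply: h; rewrite bd eqxx /= /bcol bd od; lia.
  by move=> /forall_inP /(_ _ ac) /forall_inP /(_ _ a'd).
- move=> a c d a2 ac ad cd; apply/eqP.
  by have /implyP := forallP (forallP (t4 a) c) d; apply; rewrite /unprimed a2 ac ad cd eqxx.
- move=> a c d a2 ac ad cd; apply/eqP.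
  by have /implyP := forallP (forallP (t5 a) c) d; apply; rewrite /unprimed a2 ac ad cd eqxx.
- move=> c a oc ac; have /implyP := t6 c; rewrite diagE oc eqxx => /(_ isT).
  by move=> /forall_inP; apply.
- by move=> c; rewrite t1 offset_lt.
- by move=> c a _; exact: ltn_ord.
Qed.

Lemma tab_sum_tableaux (P : pred (filling la n)) :
  (forall T, P T = tableau T && [forall c, diagonal c ==> [forall a in T c, dg (brow c) a]]) ->
  \sum_(T : filling la n | P T) beta ^+ (tab_size T - sumn la) * tab_weight beta x bs T
  = tab_sum la dg beta x bs (nth 0%N la) n.
Proof.
move=> PE; rewrite /tab_sum; apply: eq_big => [T|T]; first by rewrite istabP PE.
rewrite PE => /andP[/and5P[/forallP T0 _ _ _ _] _].
rewrite /tab_weight /cell_weight big_split /=; congr (_ * _).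
rewrite prodrXr -card_box -sum1_card /tab_size -sumnB; last first.
  by move=> c _; rewrite card_gt0.
by congr (_ ^+ _); apply: eq_bigr => c _; rewrite subn1.
Qed.

End TableauxToSums.

Lemma nondeg_tuple (F : fieldType) (beta : F) (n : nat) (x : n.-tuple F) :
  uniq x -> (forall i, 1 + beta * tnth x i != 0) ->
  nondeg beta n (fun k => nth 0 x k).
Proof.
move=> xu xn; split=> [i j iN jN ij|i iN].
  by rewrite nth_uniq ?size_tuple.
by have := xn (Ordinal iN); rewrite (tnth_nth 0).
Qed.

Section Types.
Variables (F : fieldType) (beta : F) (n : nat) (la : seq nat) (x : n.-tuple F).
Hypothesis charF0 : [pchar F] =i pred0.
Hypothesis la_strict : strict_partition la.
Hypothesis la_len : (size la <= n)%N.
Hypothesis x_uniq : uniq x.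
Hypothesis x_ndeg : forall i, 1 + beta * tnth x i != 0.

Lemma tableau_formula (dg : nat -> letter n -> bool) (bs : nat -> F)
    (head H : nat -> F -> F) (P : pred (filling la n)) :
  (forall k, 1 + beta * bs k != 0) ->
  (forall l y, (0 < l)%N -> head l y = H l y) ->
  (forall k z, (0 < k)%N -> H k.+1 z = oplus beta z (bs k) * H k z) ->
  (forall (a : nat) (o : 'I_n) y, (a <= o)%N ->
    nondeg beta (o - a) y -> away (o - a) y (tnth x o) ->
    diag_id beta (H 1%N) (diag_weight dg beta x bs a o) (o - a) y (tnth x o)) ->
  (forall T, P T = tableau T && [forall c, diagonal c ==> [forall a in T c, dg (brow c) a]]) ->
  symmetrization beta head la x =
  \sum_(T : filling la n | P T) beta ^+ (tab_size T - sumn la) * tab_weight beta x bs T.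
Proof.
move=> bs0 hH HE diagP PE; have /andP[la_sorted la0] := la_strict.
have char0 m : m.+1%:R != 0 :> F by have /pcharf0P -> := charF0.
rewrite (tab_sum_tableaux _ _ _ PE) (symmetrizationE _ _ la_len la0 hH).
rewrite (tab_sumE char0 bs0 (nondeg_tuple x_uniq x_ndeg) HE diagP (r := size la)) ?la_len //.
- move=> i; case: (ltnP i (size la)) => il; last by rewrite nth_default.
  by rewrite lt0n; apply: contraNneq la0 => <-; exact: mem_nth.
- move=> i h; have il : (i.+1 < size la)%N.
    by rewrite ltnNge; apply/negP => il; rewrite nth_default in h.
  exact: (sortedP 0%N la_sorted).
Qed.

Lemma GB_tableaux (b : nat -> F) : (forall k, 1 + beta * b k != 0) ->
  GB beta la x b = \sum_(T : filling la n | tableau'' T)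
    beta ^+ (tab_size T - sumn la) * weightI beta x b T.
Proof.
move=> b0; apply: (@tableau_formula (fun _ a => a.2) (cons0 b) _ (fun l y => \prod_(k < l) oplus beta y (cons0 b k))) => //.
- by case=> [|k] //=; rewrite mulr0 addr0 oner_neq0.
- by move=> k z _; rewrite big_ord_recr /= mulrC.
(* The diagonal admits only N, with parameter 0: the weight is t and H_1 is the identity. *)
- move=> a o y ao yn ya; rewrite /diag_weight /=.
  have -> : 0%:R * vw beta (cons0 b) (tnth x o) 0 + 1%:R * uw beta (cons0 b) (tnth x o) 0 +
     0%:R * (beta * uw beta (cons0 b) (tnth x o) 0 * vw beta (cons0 b) (tnth x o) 0) = tnth x o.
    by rewrite /uw /oplus /=; ring.
  have -> : (fun y => \prod_(k < 1) oplus beta y (cons0 b k)) = id.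
    by apply/funext => z; rewrite big_ord1 /oplus /=; ring.
  exact: diag_idB.
Qed.

Lemma GC_tableaux (b : nat -> F) : (forall k, 1 + beta * b k != 0) ->
  GC beta la x b = \sum_(T : filling la n | tableau T)
    beta ^+ (tab_size T - sumn la) * weightI beta x b T.
Proof.
move=> b0; have bs0 : forall k, 1 + beta * cons0 b k != 0.
  by case=> [|k] //=; rewrite mulr0 addr0 oner_neq0.
apply: (@tableau_formula (fun _ _ => true) (cons0 b) _
   (fun l y => oplus beta y y * \prod_(k < l.-1) oplus beta y (b k))) => //.
(* The factor z (+) z stands at the place of the parameter b_0 = 0, hence the parameters
   [cons0 b]. *)
- move=> [|k] z // _; rewrite /= big_ord_recr /=; ring.
- move=> a o y ao yn ya; rewrite /diag_weight /=.
  have -> : 1%:R * vw beta (cons0 b) (tnth x o) 0 + 1%:R * uw beta (cons0 b) (tnth x o) 0 +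
     1%:R * (beta * uw beta (cons0 b) (tnth x o) 0 * vw beta (cons0 b) (tnth x o) 0) =
     oplus beta (tnth x o) (tnth x o).
    by rewrite -(vw_t _ bs0 0); ring.
  have -> : (fun y => oplus beta y y * \prod_(k < 0) oplus beta y (b k)) =
      fun y => oplus beta y y.
    by apply/funext => z; rewrite big_ord0 mulr1.
  exact: diag_idC.
- move=> T; rewrite (_ : [forall c, _]) ?andbT //.
  by apply/forallP => c; apply/implyP => _; apply/forall_inP.
Qed.

Lemma GP_tableaux (b : nat -> F) : (forall k, 1 + beta * b k != 0) ->
  GP beta la x b = \sum_(T : filling la n | tableau' T)
    beta ^+ (tab_size T - sumn la) * weightII beta x b T.
Proof.
move=> b0.
apply: (@tableau_formula (fun i a => if odd i.+1 then a.2 == odd a.1.+1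
  else a.2 == ~~ odd a.1.+1) b _ (fun l y => \prod_(k < l) oplus beta y (b k))) => //.
- by move=> k z _; rewrite big_ord_recr /= mulrC.
- move=> a o y ao yn ya.
  have -> : (fun y => \prod_(k < 1) oplus beta y (b k)) = fun y => oplus beta y (b 0%N).
    by apply/funext => z; rewrite big_ord1.
  set om := diag_weight _ _ _ _ _ _.
  (* The diagonal letter is unprimed exactly when row and letter indices have the same parity. *)
  have -> : om = if odd (o - a) then ominus beta (tnth x o) (b 0%N)
                 else oplus beta (tnth x o) (b 0%N).
    rewrite /om /diag_weight /= oddB // /uw /vw.
    by case: (odd a); case: (odd o) => /=; ring.
  exact: diag_idD.
Qed.

End Types.

Theorem theorem9p2 (F : fieldType) (charF0 : [pchar F] =i pred0)
    (n : nat) (la : seq nat) (la_strict : strict_partition la)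
    (la_len : (size la <= n)%N)
    (beta : F) (x : n.-tuple F) (b : nat -> F)
    (x_distinct : uniq (0 :: x))
    (x_ndeg : forall i : 'I_n, 1 + beta * tnth x i != 0)
    (b_ndeg : forall k : nat, 1 + beta * b k != 0) :
  [/\ GB beta la x b =
        \sum_(T : filling la n | tableau'' T)
           beta ^+ (tab_size T - sumn la) * weightI beta x b T,
      GC beta la x b =
        \sum_(T : filling la n | tableau T)
           beta ^+ (tab_size T - sumn la) * weightI beta x b T
    & GD beta la x b =
        \sum_(T : filling la (n + odd n) | tableau' T)
           beta ^+ (tab_size T - sumn la) * weightII beta (evenpad x) b T].
Proof.
have [x0 xu] : 0 \notin x /\ uniq x by apply/andP.
split.
- exact: GB_tableaux.
- exact: GC_tableaux.
(* GD is GP in the padded variables; for n odd the added variable 0 is distinct from the others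
   because 0 is not in x. *)
- apply: GP_tableaux => //.
  + exact: leq_trans la_len (leq_addr _ _).
  + rewrite cat_uniq xu /=; case: (odd n) => //=.
    by rewrite orbF x0.
  + move=> i; rewrite (tnth_nth 0) /= nth_cat size_tuple.
    case: ltnP => [iN|_]; first by have := x_ndeg (Ordinal iN); rewrite (tnth_nth 0).
    by rewrite nth_nseq if_same mulr0 addr0 oner_neq0.
Qed.
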